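(* For nonnegative integers $k,w,n$, \[ \sum_{\substack{\lambda\vdash n\\ \lambda_1\le 2w+1,\ r(\lambda)=k}} f^{\lambda} = \sum_{\substack{t_1,\dots,t_w \in\mathbb{Z}_{\geq0}\\ t_1+\cdots+t_w=n-k}} \binom{n}{k,t_1,\dots,t_w} \det_{1\le i,j\le w} \left(\mathrm{Cat}\left(\frac{t_i+i+j-2}{2}\right)\right) \] and \[ \sum_{\substack{\lambda\vdash n\\ \lambda_1\le 2w,\ r(\lambda)=k}} f^{\lambda} = \sum_{\substack{t_1,\dots,t_w \in\mathbb{Z}_{\geq0}\\ t_1+\cdots+t_w=n}} \binom{n}{t_1,\dots,t_w} \det_{1\le i,j\le w} \left( F \left( t_i+j-1,\frac{t_i-i-k\delta_{i,w}+j}{2} \right) \right). \]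
   Context: $f^\lambda$ is the number of standard Young tableaux of shape $\lambda$; $\lambda\vdash n$ means $\lambda$ is a partition of $n$; $r(\lambda)$ is the number of rows of $\lambda$ of odd length. $\binom{n}{a_0,\dots,a_w}$ is the multinomial coefficient. $\mathrm{Cat}(m)=\frac{1}{m+1}\binom{2m}{m}$ if $m$ is a nonnegative integer and $\mathrm{Cat}(m)=0$ otherwise. For integers $r\ge 0$ and $s$, $F(r,s)=\binom{r}{s}-\binom{r}{s-1}$ (binomial coefficients vanishing outside $0\le s\le r$), and $F(r,s/2)=0$ whenever $s$ is an odd integer. $\delta_{i,w}=1$ if $i=w$ and $0$ otherwise. The determinant of an empty matrix is $1$.
   Formalization: The second identity is stated under the assumption that w > 0, n > 0 or k = 0: for w = n = 0 and k > 0 it fails as written, since the left side is an empty sum (0) while the right side is 1 (one empty tuple, empty determinant 1). *)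

(* Defs.v *)
From HB Require Import structures.
From mathcomp Require Import all_boot all_order all_algebra.

Set Implicit Arguments.
Unset Strict Implicit.
Unset Printing Implicit Defensive.

Import Order.TTheory GRing.Theory Num.Theory.

Definition is_partition_of (n : nat) (s : seq nat) : bool :=
  [&& sorted geq s, 0 \notin s & sumn s == n].

(* A partition of n has at most n parts, each at most n, so the bounds in
   {bseq n of 'I_n.+1} lose nothing; they make the type finite. *)
Definition partition_of (n : nat) : Type :=
  {s : {bseq n of 'I_n.+1} | is_partition_of n (map val s)}.
HB.instance Definition _ (n : nat) := Finite.on (partition_of n).

Definition parts (n : nat) (la : partition_of n) : seq nat :=
  map val (val la : seq 'I_n.+1).

Definition part1 (n : nat) (la : partition_of n) : nat := head 0 (parts la).

Definition odd_rows (n : nat) (la : partition_of n) : nat :=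
  count odd (parts la).

(* The Young diagram of la: cells (row, column), both numbered from 0. *)
Definition cell (n : nat) (la : partition_of n) : Type :=
  {c : 'I_n * 'I_n | c.2 < nth 0 (parts la) c.1}.
HB.instance Definition _ (n : nat) (la : partition_of n) :=
  Finite.on (cell la).

Definition cell_row (n : nat) (la : partition_of n) (c : cell la) : 'I_n :=
  (val c).1.
Definition cell_col (n : nat) (la : partition_of n) (c : cell la) : 'I_n :=
  (val c).2.

(* The entries are 0, ..., n-1 instead of 1, ..., n. *)
Definition is_SYT (n : nat) (la : partition_of n)
    (T : {ffun cell la -> 'I_n}) : bool :=
  [&& injectiveb T,
      [forall m : 'I_n, m \in codom T],
      [forall c : cell la, forall d : cell la,
         (cell_row c == cell_row d) && (cell_col c < cell_col d) ==> (T c < T d)] &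
      [forall c : cell la, forall d : cell la,
         (cell_col c == cell_col d) && (cell_row c < cell_row d) ==> (T c < T d)]].

Definition num_SYT (n : nat) (la : partition_of n) : nat :=
  #|[set T : {ffun cell la -> 'I_n} | is_SYT T]|.

(* Used only when the entries of s add up to n, where the division is exact. *)
Definition multinomial (n : nat) (s : seq nat) : nat :=
  n`! %/ \prod_(a <- s) a`!.

Local Open Scope ring_scope.

Definition Cat (x : rat) : rat :=
  if x \is a Num.nat then
    let m := Num.truncn x in 'C(2 * m, m)%:R / (m.+1)%:R
  else 0.

Definition binz (r : nat) (s : int) : nat :=
  if s is Posz m then 'C(r, m) else 0%N.

Definition F (r : nat) (x : rat) : rat :=
  if x \is a Num.int then
    let s := Num.floor x in (binz r s)%:R - (binz r (s - 1))%:R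
  else 0.

(* Main.v *)
(* Reading a standard Young tableau with at most N columns by the column of each entry gives
   a lattice word, and multiplication by p_1 turns the sum over lattice words of the
   bialternants det(x_p ^ (h_q + N - 1 - q)), h_q being the column heights, into p_1^n times
   the Vandermonde determinant.  Take N = 2w + e with e = 0 or 1, and for the variables w pairs
   z, 1/z together with e copies of t.  Applying to each z the functional
   z^d |-> t^(d-1) [d > 0] maps the bialternant to a constant times t^(number of odd rows):
   this is a Pfaffian evaluation, proved by a sign-reversing involution.  On the other side the
   Vandermonde determinant factors as
   +- prod (z - 1/z) (1 - t y + t^2)^e * V(y)^2 with y = z + 1/z, so Andreief's identity
   produces determinants of ballot numbers: for e = 1 directly, and for e = 0 after rewriting
   V(y) in Chebyshev polynomials.  Multiplicative constants are never computed, they are fixed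
   by the case n = 0.  Finally the coefficients of t^k are compared. *)

Require Import Defs.
From mathcomp Require Import all_boot all_order all_algebra all_fingroup.
From mathcomp Require Import zify ring lra.

Set Implicit Arguments.
Unset Strict Implicit.
Unset Printing Implicit Defensive.

Import Order.TTheory GRing.Theory Num.Theory.

Local Open Scope ring_scope.

(** * Bialternants and lattice words *)

Section Bialternants.

Variables (N : nat) (x : 'I_N -> rat).

Definition bialternant (l : 'I_N -> nat) : rat :=
  \det (\matrix_(p < N, q < N) x p ^+ l q).

Lemma eq_bialternant l l' : l =1 l' -> bialternant l = bialternant l'.
Proof. by move=> h; congr (\det _); apply/matrixP => p q; rewrite !mxE h. Qed.

Lemma bialternant_eq0 (l : 'I_N -> nat) q q' :
  q != q' -> l q = l q' -> bialternant l = 0.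
Proof.
move=> ne E; rewrite /bialternant -det_tr.
by apply: (determinant_alternate ne) => p; rewrite !mxE E.
Qed.

(** In the Leibniz term of [s], a factor [x p] raises the exponent in column [s p]; summing over the
    rows [p] is summing over the columns. *)
Lemma sum_mul_bialternant (l : 'I_N -> nat) :
  (\sum_p x p) * bialternant l
  = \sum_q bialternant (fun r => l r + (r == q))%N.
Proof.
rewrite /bialternant /determinant exchange_big /= mulr_sumr.
apply: eq_bigr => s _; rewrite -mulr_sumr mulrCA; congr (_ * _).
rewrite mulr_suml (reindex_inj (@perm_inj _ s^-1)) /=.
apply: eq_bigr => q _; rewrite (bigD1 (s^-1 q)%g) //= [RHS](bigD1 (s^-1 q)%g) //=.
rewrite !mxE permKV eqxx addn1 exprS mulrA; congr (_ * _).
apply: eq_bigr => p ne; rewrite !mxE; case: eqP => [E|_]; last by rewrite addn0.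
by rewrite -E permK eqxx in ne.
Qed.

End Bialternants.

(** * Lattice words and powers of the first power sum *)

Section LatticeWords.

Variable N : nat.

Definition occ n (W : {ffun 'I_n -> 'I_N}) (i : nat) (q : 'I_N) : nat :=
  (\sum_(j < n | j < i) (W j == q))%N.

(** Yamanouchi words: position [j] holds the column that receives entry [j] of a tableau, and every
    prefix has weakly decreasing column heights. *)
Definition lattice_word n (W : {ffun 'I_n -> 'I_N}) : bool :=
  [forall i : 'I_n.+1, forall q : 'I_N, forall q' : 'I_N,
     (q <= q')%N ==> (occ W i q' <= occ W i q)%N].

Lemma lattice_wordP n (W : {ffun 'I_n -> 'I_N}) :
  reflect (forall (i : nat) (q q' : 'I_N),
             (i <= n)%N -> (q <= q')%N -> (occ W i q' <= occ W i q)%N)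
          (lattice_word W).
Proof.
apply: (iffP idP) => [h i q q' hi hq|h]; last first.
  by do 3![apply/forallP => ?]; apply/implyP => hq; apply: h; rewrite // -ltnS.
have := h => /forallP /(_ (Ordinal (hi : i < n.+1)%N)) /forallP /(_ q).
by move/forallP/(_ q')/implyP/(_ hq).
Qed.

Definition word_rcons n (W : {ffun 'I_n -> 'I_N}) (q : 'I_N) : {ffun 'I_n.+1 -> 'I_N} :=
  [ffun i => if unlift ord_max i is Some j then W j else q].

Lemma sum_word_rcons n (P : pred {ffun 'I_n.+1 -> 'I_N})
    (F : {ffun 'I_n.+1 -> 'I_N} -> rat) :
  \sum_(W | P W) F W
  = \sum_(W : {ffun 'I_n -> 'I_N}) \sum_(q | P (word_rcons W q)) F (word_rcons W q).
Proof.
rewrite pair_big_dep /=.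
pose h (Wq : {ffun 'I_n -> 'I_N} * 'I_N) := word_rcons Wq.1 Wq.2.
pose g (W : {ffun 'I_n.+1 -> 'I_N}) := ([ffun j => W (lift ord_max j)], W ord_max).
have gK : cancel g h.
  move=> W; apply/ffunP => i; rewrite !ffunE /=.
  by case: unliftP => [j ->|->] //=; rewrite !ffunE.
have hK : cancel h g.
  move=> [W q]; rewrite /g /h /=; congr (_, _); last by rewrite !ffunE unlift_none.
  by apply/ffunP => i; rewrite !ffunE liftK.
by rewrite (reindex h) //; exists g => ? _; rewrite ?gK ?hK.
Qed.

Lemma occ_rcons n (W : {ffun 'I_n -> 'I_N}) q i r : (i <= n.+1)%N ->
  occ (word_rcons W q) i r = (occ W i r + ((i == n.+1) && (r == q)))%N.
Proof.
move=> hi; rewrite /occ big_mkcond big_ord_recr /= !ffunE unlift_none.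
congr addn.
  rewrite [RHS]big_mkcond; apply: eq_bigr => j _ /=; rewrite ffunE.
  suff -> : unlift ord_max (widen_ord (leqnSn n) j) = Some j by [].
  rewrite -(liftK ord_max j); congr unlift; apply: val_inj.
  by rewrite /= /bump leqNgt ltn_ord.
by rewrite eqn_leq hi /= eq_sym; case: (n < i)%N.
Qed.

Lemma occ_ge n (W : {ffun 'I_n -> 'I_N}) i q : (n <= i)%N -> occ W i q = occ W n q.
Proof.
by move=> h; apply: eq_bigl => j; rewrite ltn_ord (leq_trans (ltn_ord j) h).
Qed.

Lemma lattice_word_rcons n (W : {ffun 'I_n -> 'I_N}) q :
  lattice_word (word_rcons W q) ->  lattice_word W.
Proof.
move/lattice_wordP => h; apply/lattice_wordP => i r r' hi hr.
have := h i r r' (leqW hi) hr; rewrite !occ_rcons ?(leqW hi) //.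
by rewrite ltn_eqF ?ltnS // !addn0.
Qed.

(** If appending [q] breaks the lattice condition, columns [q - 1] and [q] had equal heights;
    afterwards their exponents coincide and the matrix has two equal columns. *)
Lemma lattice_word_bialternant x n (W : {ffun 'I_n -> 'I_N}) q :
  lattice_word W -> ~~ lattice_word (word_rcons W q) ->
  bialternant x (fun r => occ (word_rcons W q) n.+1 r + (N - r.+1))%N = 0.
Proof.
move=> /lattice_wordP lW nl.
(* If some column left of [q] has the height of [q], so has its neighbour [q - 1], by
   monotonicity. *)
have [/existsP[r /andP[rq E]]|/existsPn nr] :=
    boolP [exists r : 'I_N, (r < q)%N && (occ W n r == occ W n q)].
  have qN := ltn_ord q; have hq1 : (q.-1 < N)%N by lia.
  pose q1 := Ordinal hq1.
  have E1 : occ W n q1 = occ W n q.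
    apply/eqP; rewrite eqn_leq -{1}(eqP E) !lW //=; lia.
  apply: (@bialternant_eq0 _ _ _ q1 q).
    by rewrite -val_eqE /=; lia.
  rewrite !occ_rcons // eqxx /= -val_eqE /= !occ_ge // E1 eqxx.
  by rewrite (_ : (q.-1 == q) = false); lia.
(* Otherwise all columns left of [q] are strictly higher, and the longer word is still a lattice
   word. *)
case/negP: nl; apply/lattice_wordP => i r r' hi hr.
rewrite !occ_rcons //; case: eqP hi => [->|ni] hi /=; last first.
  by rewrite !addn0; apply: lW => //; lia.
rewrite !occ_ge //.
have h := lW n r r' (leqnn n) hr.
have [E|ne] := eqVneq r' q; last by rewrite addn0; lia.
have [//|ne'] := eqVneq r q; first by rewrite leq_add2r.
rewrite addn0 addn1 ltn_neqAle h andbT.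
have := nr r; rewrite negb_and -E eq_sym => /orP[|//].
rewrite -leqNgt => hr'; exfalso; move/eqP: ne'; apply; apply: val_inj => /=.
by move: hr hr'; rewrite E /=; lia.
Qed.

Lemma sum_words0 (G : {ffun 'I_0 -> 'I_N} -> rat) (a : rat) :
  (forall W, G W = a) -> \sum_(W | lattice_word W) G W = a.
Proof.
move=> GE; rewrite (eq_bigr (fun=> a)) // (big_pred1 [ffun i : 'I_0 =>
  match i with Ordinal _ h => False_rect _ (notF h) end]) // => W /=.
have -> : lattice_word W.
  by apply/lattice_wordP => i q q' _ _; rewrite /occ !big_ord0.
by apply/esym/eqP/ffunP; case.
Qed.

(** Induction on the length: a factor [\sum_p x p] appends a letter in all ways, and the extensions
    that are not lattice words contribute 0. *)
Lemma sum_lattice_bialternant x n :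
  \sum_(W : {ffun 'I_n -> 'I_N} | lattice_word W)
     bialternant x (fun q => occ W n q + (N - q.+1))%N
  = (\sum_p x p) ^+ n * bialternant x (fun q => N - q.+1)%N.
Proof.
elim: n => [|n IH].
  rewrite mul1r; apply: sum_words0 => W; apply: eq_bialternant => q.
  by rewrite /occ big_ord0.
rewrite sum_word_rcons exprS -mulrA -{}IH mulr_sumr [RHS]big_mkcond.
apply: eq_bigr => W _; case: ifPn => [lW|nlW]; last first.
  by rewrite big_pred0 // => q; apply: contraNF nlW; apply: lattice_word_rcons.
rewrite sum_mul_bialternant big_mkcond; apply: eq_bigr => q _.
case: ifPn => [lWq|nl].
  apply: eq_bialternant => r; rewrite occ_rcons // eqxx occ_ge //.
  by rewrite addnAC.
rewrite -(lattice_word_bialternant x lW nl).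
by apply: eq_bialternant => r; rewrite occ_rcons // eqxx occ_ge // addnAC.
Qed.

End LatticeWords.
(** * Standard Young tableaux as lattice words *)

Section Occurrences.

Variables (N n : nat) (W : {ffun 'I_n -> 'I_N}).
Implicit Types (i : nat) (j : 'I_n) (q : 'I_N).

Lemma occS j q : occ W j.+1 q = (occ W j q + (W j == q))%N.
Proof.
rewrite /occ (bigD1 j) //= addnC; congr addn; apply: eq_bigl => k.
by rewrite ltnS ltn_neqAle andbC -val_eqE.
Qed.

Lemma occ_mono q : {homo (fun i => occ W i q) : i i' / (i <= i')%N}.
Proof.
move=> i i' h; rewrite /= /occ [leqLHS]big_mkcond [leqRHS]big_mkcond /=.
by apply: leq_sum => j _; case: ifP => // ji; rewrite (leq_trans ji h).
Qed.

Lemma occ_ltn i j q : W j = q -> (j < i)%N -> (occ W j q < occ W i q)%N.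
Proof.
move=> Wj ji; apply: (@leq_trans (occ W j.+1 q)); last exact: occ_mono.
by rewrite occS Wj eqxx addn1.
Qed.

Lemma occ_inj j j' q : W j = q -> W j' = q -> occ W j q = occ W j' q -> j = j'.
Proof.
move=> h h' E; apply: val_inj; case: (ltngtP j j') => // lt.
  by have := occ_ltn h lt; rewrite E ltnn.
by have := occ_ltn h' lt; rewrite E ltnn.
Qed.

(** Finds occurrence number [r] of the letter [q], counted from 0; its position will be the entry of
    the cell in row [r], column [q]. *)
Lemma occ_find r i q : (i <= n)%N -> (r < occ W i q)%N ->
  exists j : 'I_n, [/\ (j < i)%N, W j = q & occ W j q = r].
Proof.
elim: i => [|i IH] hi; first by rewrite /occ big_pred0.
have := occS (Ordinal hi) q; rewrite /= => ->.
have [E|_] := eqVneq (W (Ordinal hi)) q; last first.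
  by rewrite addn0 => /(IH (ltnW hi))[j [h1 h2 h3]]; exists j; rewrite ltnW.
rewrite addn1 ltnS leq_eqVlt => /orP[/eqP->|].
  by exists (Ordinal hi).
by move=> /(IH (ltnW hi))[j [h1 h2 h3]]; exists j; rewrite ltnW.
Qed.

Lemma occ_le i q : (occ W i q <= n)%N.
Proof.
apply: (@leq_trans (\sum_(j < n) 1)%N); last by rewrite sum1_card card_ord.
rewrite /occ big_mkcond; apply: leq_sum => j _.
by case: ifP => // _; apply: leq_b1.
Qed.

Lemma sum_occ : (\sum_q occ W n q = n)%N.
Proof.
rewrite /occ exchange_big /=.
under eq_bigr => j _.
  rewrite (bigD1 (W j)) //= eqxx big1 ?addn0; last first.
    by move=> q; rewrite eq_sym => /negbTE->.
  over.
by rewrite (eq_bigl xpredT) ?sum1_card ?card_ord // => j; rewrite ltn_ord.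
Qed.

End Occurrences.

(** A downward closed predicate holds on an initial segment, whose length is the sum. This is how
    row lengths and column heights determine each other. *)
Lemma ltn_sum_initial n (P : pred nat) :
  (forall a b, (a <= b)%N -> P b -> P a) ->
  forall r, (r < \sum_(i < n) P i)%N = (r < n)%N && P r.
Proof.
move=> mono r; elim: n => [|n IH]; first by rewrite big_ord0.
rewrite big_ord_recr /=; case Pn : (P n).
  rewrite (eq_bigr (fun=> 1%N)); last by move=> i _; rewrite (mono i n) // ltnW.
  rewrite sum1_card card_ord addn1; case: ltnP => //= h.
  by rewrite (mono r n).
rewrite addn0 IH [(r < n.+1)%N]ltnS [(r <= n)%N]leq_eqVlt.
by case: eqVneq => [->|//]; rewrite ltnn Pn.
Qed.

(** Double counting of the pairs in [R]: the bijection is given as a relation with unique partners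
    on both sides. *)
Lemma card_matching (A B : finType) (P : pred A) (Q : pred B) (R : A -> B -> bool) :
  (forall a, P a -> exists2 b, Q b && R a b & forall b', Q b' -> R a b' -> b' = b) ->
  (forall b, Q b -> exists2 a, P a && R a b & forall a', P a' -> R a' b -> a' = a) ->
  #|[set a | P a]| = #|[set b | Q b]|.
Proof.
move=> hA hB; rewrite -!sum1_card.
transitivity (\sum_(a | P a) \sum_(b | Q b && R a b) 1)%N.
  under eq_bigl do rewrite inE; apply: eq_bigr => a /hA[b Qb ub].
  rewrite (big_pred1 b) // => b' /=; apply/idP/eqP => [/andP[]|->//].
  exact: ub.
rewrite (exchange_big_dep Q) /=; last by move=> a b _ /andP[].
under [RHS]eq_bigl do rewrite inE; apply: eq_bigr => b Qb.
have [a /andP[Pa Ra] ua] := hB _ Qb.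
rewrite (big_pred1 a) // => a' /=; rewrite Qb /=.
by apply/idP/eqP => [/andP[]|->]; [apply: ua | rewrite Pa].
Qed.

(** * Rows, cells and columns of a Young diagram *)

Section Shapes.

Variables (n : nat) (la : partition_of n).
Local Notation row_len r := (nth 0%N (parts la) r).

Lemma partsP : is_partition_of n (parts la).
Proof. exact: valP la. Qed.

Lemma row_len_mono r r' : (r <= r')%N -> (row_len r' <= row_len r)%N.
Proof.
have /and3P[so _ _] := partsP; move=> h.
have [sr|sr] := ltnP r' (size (parts la)); last by rewrite nth_default.
apply: (sorted_leq_nth _ _ 0%N so r r') => //.
- by move=> a b c /= h1 h2; apply: leq_trans h2 h1.
- by move=> a /=.
- by rewrite inE (leq_ltn_trans h).
Qed.

Lemma size_parts : (size (parts la) <= n)%N.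
Proof. by rewrite size_map size_bseq. Qed.

Lemma row_len_le r : (row_len r <= n)%N.
Proof.
have [sr|sr] := ltnP r (size (parts la)); last by rewrite nth_default.
rewrite /parts (nth_map (ord0 : 'I_n.+1)); last by move: sr; rewrite size_map.
by rewrite -ltnS ltn_ord.
Qed.

Lemma row_len_gt0 r : (0 < row_len r)%N = (r < size (parts la))%N.
Proof.
have [sr|sr] := ltnP r (size (parts la)); last by rewrite nth_default.
have /and3P[_ n0 _] := partsP; rewrite lt0n; apply: contra n0 => /eqP <-.
exact: mem_nth.
Qed.

Lemma row_len_lt r q : (q < row_len r)%N -> (r < n)%N /\ (q < n)%N.
Proof.
move=> h; split; last by apply: leq_trans h (row_len_le r).
by apply: leq_trans size_parts; rewrite -row_len_gt0 (leq_ltn_trans _ h).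
Qed.

Lemma cell_lt (c : cell la) : (cell_col c < row_len (cell_row c))%N.
Proof. exact: valP c. Qed.

Lemma cell_exists r q : (q < row_len r)%N ->
  exists c : cell la, cell_row c = r :> nat /\ cell_col c = q :> nat.
Proof.
move=> h; have [rn qn] := row_len_lt h.
pose P (c : 'I_n * 'I_n) := (c.2 < row_len c.1)%N.
by exists (exist P (Ordinal rn, Ordinal qn) h).
Qed.

Lemma cell_eq (c d : cell la) :
  cell_row c = cell_row d :> nat -> cell_col c = cell_col d :> nat -> c = d.
Proof.
move=> /val_inj h1 /val_inj h2; apply: val_inj; move: h1 h2.
by rewrite /cell_row /cell_col; case: (val c) (val d) => [a b] [a' b'] /= -> ->.
Qed.

Lemma sum_column (q : nat) (f : nat -> nat) :
  (\sum_(c : cell la | cell_col c == q :> nat) f (cell_row c)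
   = \sum_(r < n) (q < row_len r) * f r)%N.
Proof.
rewrite (partition_big (fun c => cell_row c) xpredT) //=; apply: eq_bigr => r _.
have [h|h] := ltnP q (row_len r).
  have [c [rc qc]] := cell_exists h; rewrite (big_pred1 c).
    by rewrite rc mul1n.
  move=> d /=; apply/andP/eqP => [[/eqP h1 /eqP h2]|->]; last first.
    by rewrite qc -val_eqE /= rc !eqxx.
  by apply: cell_eq; rewrite ?h2 ?h1.
rewrite mul0n big_pred0 // => d; apply/andP => -[/eqP h1 /eqP h2].
by have := cell_lt d; rewrite h1 h2 ltnNge h.
Qed.

Lemma row_len_part1 r : (row_len r <= part1 la)%N.
Proof. by rewrite /part1 -nth0; apply: row_len_mono. Qed.

Lemma odd_rowsE : odd_rows la = (\sum_(r < n) odd (row_len r))%N.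
Proof.
rewrite /odd_rows -sumn_count sumnE big_map /= (big_nth 0%N) big_mkord.
rewrite (big_ord_widen n (fun r => odd (row_len r) : nat)) ?size_parts //.
rewrite big_mkcond; apply: eq_bigr => r _; case: ltnP => // h.
by rewrite nth_default.
Qed.

Variable N : nat.
Implicit Types (W : {ffun 'I_n -> 'I_N}) (T : {ffun cell la -> 'I_n}).

(** Only columns below [N] are compared, so this pins down [la] only together with
    [part1 la <= N]. *)
Definition has_shape W : bool :=
  [forall r : 'I_n, forall q : 'I_N, (q < row_len r)%N == (r < occ W n q)%N].

Lemma has_shapeP W : has_shape W ->
  forall (r : nat) (q : 'I_N), (q < row_len r)%N = (r < occ W n q)%N.
Proof.
move=> h r q; have [rn|rn] := ltnP r n.
  by have /eqP := forallP (forallP h (Ordinal rn)) q.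
apply/idP/idP => h'; first by have [] := row_len_lt h'; rewrite ltnNge rn.
by have := leq_trans h' (occ_le W n q); rewrite ltnNge rn.
Qed.

(** A relation and not a map from [T], since a column number is a letter only when it is below
    [N]. *)
Definition column_word T W : bool := [forall c, W (T c) == cell_col c :> nat].

Lemma is_SYT_bij T : is_SYT T -> bijective T.
Proof.
move=> /and4P[/injectiveP iT /forallP cT _ _].
exists (fun m => iinv (cT m)) => [c|m]; last exact: f_iinv.
by apply: iT; rewrite f_iinv.
Qed.

Lemma SYT_column_lt T c d : is_SYT T -> cell_col c = cell_col d :> nat ->
  (T c < T d)%N = (cell_row c < cell_row d)%N.
Proof.
move=> /and4P[_ _ _ /forallP up] /val_inj E.
have lt a b : cell_col a = cell_col b -> (cell_row a < cell_row b)%N -> (T a < T b)%N.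
  by move=> h1 h2; have /forallP/(_ b)/implyP := up a; apply; rewrite h1 eqxx.
case: (ltngtP (cell_row c) (cell_row d)) => [h|h|h]; first by rewrite lt.
  by apply/negbTE; rewrite -leqNgt ltnW // lt.
by rewrite (cell_eq h (congr1 val E)) ltnn.
Qed.

Lemma column_word_occ T W : is_SYT T -> column_word T W -> forall i q,
  occ W i q = (\sum_(c | cell_col c == q :> nat) (T c < i))%N.
Proof.
move=> sT /forallP cw i q; rewrite /occ big_mkcond.
rewrite (reindex T) /=; last exact: onW_bij (is_SYT_bij sT).
rewrite [RHS]big_mkcond; apply: eq_bigr => c _.
by rewrite -val_eqE /= (eqP (cw c)); case: eqP; case: ltnP.
Qed.

(** Entries increase down a column, so those smaller than [T c] in its column are exactly the ones
    in the rows above [c]. *)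
Lemma column_word_row T W c (q : 'I_N) : is_SYT T -> column_word T W ->
  cell_col c = q :> nat -> occ W (T c) q = cell_row c.
Proof.
move=> sT cw E; rewrite (column_word_occ sT cw).
under eq_bigr => d /eqP h do rewrite SYT_column_lt ?h ?E //.
rewrite (sum_column q (fun r => (r < cell_row c)%N)).
transitivity (\sum_(r < n) (r < cell_row c)%N)%N.
  apply: eq_bigr => r _; case: (ltnP r (cell_row c)) => [h|_]; last by rewrite muln0.
  rewrite -E (leq_trans (cell_lt c)) //; exact/row_len_mono/ltnW.
have rn : (cell_row c <= n)%N by rewrite ltnW.
transitivity (\sum_(r < n | r < cell_row c) 1)%N.
  by rewrite [RHS]big_mkcond; apply: eq_bigr => r _; case: ltnP.
by rewrite -(big_ord_widen n (fun=> 1%N)) // sum1_card card_ord.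
Qed.

Lemma column_word_shape T W : is_SYT T -> column_word T W -> has_shape W.
Proof.
move=> sT cw; apply/forallP => r; apply/forallP => q; apply/eqP.
rewrite (column_word_occ sT cw).
under eq_bigr do rewrite ltn_ord; rewrite (sum_column q (fun=> 1%N)).
under eq_bigr do rewrite muln1.
rewrite (@ltn_sum_initial n (fun r => q < row_len r)%N) ?ltn_ord //.
by move=> a b h1 h2; apply: leq_trans h2 (row_len_mono h1).
Qed.

(** A cell of column [q'] filled before time [i] has in its row a cell of column [q] with a smaller
    entry; the last such row, [a], gives the inequality. *)
Lemma column_word_lattice T W : is_SYT T -> column_word T W -> lattice_word W.
Proof.
move=> sT cw; have /has_shapeP shW := column_word_shape sT cw.
apply/lattice_wordP => i q q' hi; rewrite leq_eqVlt => /orP[/eqP/val_inj->//|qq'].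
case E : (occ W i q') => [//|a].
have [|j [ji Wj oj]] := @occ_find _ _ W a i q' hi; first by rewrite E.
have [g gK Kg] := is_SYT_bij sT; pose c := g j.
have Tc : T c = j by rewrite /c Kg.
have colc : cell_col c = q' :> nat by rewrite -(eqP (forallP cw c)) Tc Wj.
have rowc : cell_row c = a :> nat by rewrite -(column_word_row sT cw colc) Tc.
have [|d [rd qd]] := @cell_exists a q.
  by rewrite (ltn_trans qq') // -colc -rowc cell_lt.
have Td : (T d < T c)%N.
  have /and4P[_ _ /forallP/(_ d)/forallP/(_ c)/implyP h _] := sT.
  by apply: h; rewrite -val_eqE /= rd rowc eqxx qd colc.
have Wd : W (T d) = q by apply: val_inj; rewrite /= (eqP (forallP cw d)) qd.
rewrite -rd -(column_word_row sT cw qd).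
by apply: occ_ltn => //; rewrite (ltn_trans Td) // Tc.
Qed.

Lemma card_SYT_words : (part1 la <= N)%N ->
  num_SYT la = #|[set W | lattice_word W && has_shape W]|.
Proof.
move=> hN; apply: (card_matching (R := column_word)) => [T sT|W].
  have [g gK Kg] := is_SYT_bij sT.
  have ltN (c : cell la) : (cell_col c < N)%N.
    by apply: leq_trans (cell_lt c) (leq_trans (row_len_part1 _) hN).
  pose W : {ffun 'I_n -> 'I_N} := [ffun j => Ordinal (ltN (g j))].
  have cw : column_word T W by apply/forallP => c; rewrite ffunE gK.
  exists W; first by rewrite cw (column_word_lattice sT cw) (column_word_shape sT cw).
  move=> W' _ cw'; apply/ffunP => j; apply: val_inj; rewrite -(Kg j).
  by rewrite /= (eqP (forallP cw _)) (eqP (forallP cw' _)).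
(* Conversely, the cell in row [r] and column [q] receives the position of occurrence [r] of the
   letter [q]. *)
move=> /andP[/lattice_wordP lW /has_shapeP shW].
have ltN (c : cell la) : (cell_col c < N)%N.
  by apply: leq_trans (cell_lt c) (leq_trans (row_len_part1 _) hN).
pose col (c : cell la) := Ordinal (ltN c).
have /fin_all_exists[T0 hT0] : forall c : cell la, exists j : 'I_n,
    W j = col c /\ occ W j (col c) = cell_row c.
  move=> c; have : (cell_row c < occ W n (col c))%N by rewrite -shW cell_lt.
  by move=> /(occ_find (leqnn n))[j [_ h1 h2]]; exists j.
pose T : {ffun cell la -> 'I_n} := [ffun c => T0 c].
have WT c : W (T c) = col c by rewrite ffunE; have [] := hT0 c.
have oT c : occ W (T c) (col c) = cell_row c by rewrite ffunE; have [] := hT0 c.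
have cw : column_word T W by apply/forallP => c; rewrite WT.
have sT : is_SYT T.
  apply/and4P; split.
  - apply/injectiveP => c d E.
    have Ecd : col c = col d by rewrite -!WT E.
    by apply: cell_eq; [rewrite -!oT E Ecd | apply: (congr1 val Ecd)].
  - apply/forallP => j.
    have [|c [rc qc]] := @cell_exists (occ W j (W j)) (W j).
      by rewrite shW occ_ltn.
    have Ec : col c = W j by apply: val_inj.
    apply/codomP; exists c; apply: (occ_inj (q := W j)) => //.
      by rewrite WT Ec.
    by rewrite -Ec oT rc -Ec.
  (* Rows increase: once position [T d] is read, the letter [col d] has occurred more than
     [cell_row d] times, hence so has [col c] by the lattice condition. *)
  - apply/forallP => c; apply/forallP => d; apply/implyP => /andP[/eqP rE cl].
    have h : (cell_row d < occ W (T d).+1 (col d))%N.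
      by rewrite occS WT eqxx oT addn1.
    have h' := leq_trans h (lW _ (col c) (col d) (ltn_ord (T d)) (ltnW cl)).
    have : (T c < (T d).+1)%N.
      rewrite ltnNge; apply/negP => /(occ_mono W (col c)).
      by rewrite oT rE leqNgt h'.
    rewrite ltnS leq_eqVlt => /orP[/eqP/val_inj E|//].
    by move: cl; rewrite (_ : cell_col c = cell_col d) ?ltnn //; apply: val_inj;
       rewrite -[LHS]/(val (col c)) -[RHS]/(val (col d)) -!WT E.
  - apply/forallP => c; apply/forallP => d; apply/implyP => /andP[/eqP cE rl].
    have Ecd : col c = col d by apply: val_inj; rewrite /= cE.
    rewrite ltnNge; apply/negP => /(occ_mono W (col c)).
    by rewrite oT Ecd oT leqNgt rl.
exists T; first by rewrite sT cw.
move=> T' sT' cw'; apply/ffunP => c.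
have WT' : W (T' c) = col c by apply: val_inj; rewrite /= (eqP (forallP cw' c)).
apply: (occ_inj WT' (WT c)); rewrite oT.
exact: (column_word_row sT' cw').
Qed.

(** Along a row the factors [t] and [t^-1] alternate from column 0, so the row contributes [t] if
    its length is odd and 1 if it is even. *)
Lemma has_shape_weight (t : rat) W : t != 0 -> has_shape W -> (part1 la <= N)%N ->
  t ^+ odd_rows la = \prod_(q < N) (if odd q then t^-1 else t) ^+ occ W n q.
Proof.
move=> t0 /has_shapeP shW hN; rewrite odd_rowsE expr_sum.
have occE (q : 'I_N) : occ W n q = (\sum_(r < n) (q < row_len r)%N)%N.
  under eq_bigr do rewrite shW.
  rewrite -[LHS]card_ord -sum1_card (big_ord_widen n (fun=> 1%N)) ?occ_le //.
  by rewrite big_mkcond; apply: eq_bigr => r _; case: ltnP.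
under [RHS]eq_bigr do rewrite occE expr_sum.
rewrite exchange_big; apply: eq_bigr => r _.
have := leq_trans (row_len_part1 r) hN; set k := row_len r => hk.
transitivity (\prod_(q < N | (q < k)%N) (if odd q then t^-1 else t)); last first.
  by rewrite [LHS]big_mkcond; apply: eq_bigr => q _; case: ltnP => //; rewrite expr1.
rewrite -(big_ord_widen N (fun q => if odd q then t^-1 else t)) //.
elim: k {hk} => [|k IH]; first by rewrite big_ord0.
by rewrite big_ord_recr /= -IH; case: (odd k) => /=; rewrite ?expr0 ?mul1r // divff.
Qed.

End Shapes.

(** * Shapes of lattice words *)

Lemma eq_partition n (la mu : partition_of n) :
  (forall r, nth 0%N (parts la) r = nth 0%N (parts mu) r) -> la = mu.
Proof.
move=> E; have sz : size (parts la) = size (parts mu).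
  case: (ltngtP (size (parts la)) (size (parts mu))) => // h.
    by have := h; rewrite -row_len_gt0 -E row_len_gt0 ltnn.
  by have := h; rewrite -row_len_gt0 E row_len_gt0 ltnn.
do 2!apply: val_inj; apply: (inj_map val_inj).
exact: (@eq_from_nth _ 0%N).
Qed.

Lemma partition_exists n (s : seq nat) : is_partition_of n s ->
  exists la : partition_of n, parts la = s.
Proof.
move=> hs; have /and3P[_ n0 /eqP sn] := hs.
have sz : (size s <= n)%N.
  rewrite -sn sumnE -(size_map (fun=> 1%N)) -sum1_size big_map.
  rewrite !big_seq; apply: leq_sum => a sa.
  by rewrite lt0n; apply: contra n0 => /eqP <-.
have le a : a \in s -> (a < n.+1)%N.
  by move=> sa; rewrite ltnS -sn sumnE (big_rem a) //= leq_addr.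
have E : map val (map (@inord n) s) = s.
  rewrite -map_comp map_id_in // => a sa /=; exact/inordK/le.
have sz' : (size (map (@inord n) s) <= n)%N by rewrite size_map.
pose b : {bseq n of 'I_n.+1} := Bseq sz'.
have hb : is_partition_of n (map val b) by rewrite /= E.
by exists (exist _ b hb).
Qed.

Lemma nth_filter_pos (s : seq nat) r : sorted geq s ->
  nth 0%N [seq a <- s | (0 < a)%N] r = nth 0%N s r.
Proof.
elim: s r => [|a s IH] r //= so.
have so' := path_sorted so.
case: posnP => [a0|_] /=; last by case: r => //= r; apply: IH.
have all0 : all (pred1 0%N) s.
  have tr : transitive geq by move=> x y z /= h1 h2; apply: leq_trans h2 h1.
  have := order_path_min tr so; rewrite a0; apply: sub_all => x /=.
  by rewrite leqn0.
rewrite IH // a0 (all_pred1P _ _ all0) !nth_nseq.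
by case: r => [|r] /=; rewrite ?nth_nseq; do ?case: ifP.
Qed.

Lemma lattice_word_shape n N (W : {ffun 'I_n -> 'I_N}) : lattice_word W ->
  exists la : partition_of n, has_shape la W && (part1 la <= N)%N.
Proof.
move=> /lattice_wordP lW.
(* [c r] is the length of row [r], from the conjugate of the column heights; the trailing zeros are
   filtered out in [s']. *)
pose c r := (\sum_(q < N) (r < occ W n q))%N.
pose s := [seq c r | r <- iota 0 n].
have cE (r : nat) (q : 'I_N) : (q < c r)%N = (r < occ W n q)%N.
  pose P q := if insub q is Some q' then (r < occ W n q')%N else false.
  rewrite /c (eq_bigr (fun q : 'I_N => P q : nat)); last by move=> i _; rewrite /P valK.
  rewrite ltn_sum_initial ?ltn_ord /= /P ?valK // => a b ab.
  case: insubP => // b' _ Eb; case: insubP => [a' _ Ea|]; last first.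
    by rewrite -leqNgt => h; have := ltn_ord b'; rewrite Eb ltnNge (leq_trans h).
  by move=> h; rewrite (leq_trans h) // lW // Ea Eb.
have so : sorted geq s.
  have tr : transitive geq by move=> x y z /= h1 h2; apply: leq_trans h2 h1.
  rewrite (sorted_pairwise tr) pairwise_map.
  apply: (sub_pairwise (r := leq)) => [a b ab|]; last first.
    by rewrite -(sorted_pairwise leq_trans) iota_sorted.
  by apply: leq_sum => q _; case: (ltnP b) => // h; rewrite (leq_ltn_trans ab).
pose s' := [seq a <- s | (0 < a)%N].
have ps : is_partition_of n s'.
  apply/and3P; split.
  - by apply: sorted_filter => // x y z /= h1 h2; apply: leq_trans h2 h1.
  - by rewrite mem_filter.
  - rewrite sumnE big_filter -[X in _ == X](sum_occ W).
    rewrite [X in X == _](_ : _ = \sum_(a <- s) a)%N; last first.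
      by rewrite big_mkcond; apply: eq_bigr => a _; case: posnP.
    rewrite big_map -{1}(subn0 n) -/(index_iota 0 n) big_mkord exchange_big /=.
    apply/eqP; apply: eq_bigr => q _.
    rewrite -[RHS]card_ord -sum1_card (big_ord_widen n (fun=> 1%N)) ?occ_le //.
    by rewrite [RHS]big_mkcond; apply: eq_bigr => r _; case: ltnP.
have [la E] := partition_exists ps; exists la.
have nE r : (r < n)%N -> nth 0%N (parts la) r = c r.
  move=> rn; rewrite E nth_filter_pos // (nth_map 0%N) ?size_iota //.
  by rewrite nth_iota.
apply/andP; split.
  by apply/forallP => r; apply/forallP => q; rewrite nE // cE.
rewrite /part1 -nth0; have [n0|n0] := posnP n.
  by rewrite nth_default // (leq_trans (size_parts la)) // n0.
rewrite nE //; apply: (@leq_trans (\sum_(q < N) 1)%N); last by rewrite sum1_card card_ord.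
by apply: leq_sum => q _; apply: leq_b1.
Qed.

(** If row [r] is shorter in one shape, the column just after its end tells the shapes apart; it is
    below [N] because the other shape has at most [N] columns. *)
Lemma has_shape_unique n N (W : {ffun 'I_n -> 'I_N}) (la mu : partition_of n) :
  has_shape la W -> (part1 la <= N)%N -> has_shape mu W -> (part1 mu <= N)%N ->
  la = mu.
Proof.
move=> /has_shapeP h1 l1 /has_shapeP h2 l2; apply: eq_partition => r.
have b1 := leq_trans (row_len_part1 la r) l1.
have b2 := leq_trans (row_len_part1 mu r) l2.
case: (ltngtP (nth 0%N (parts la) r) (nth 0%N (parts mu) r)) => // h.
  by have := h; rewrite -[X in (X < _)%N]/(val (Ordinal (leq_trans h b2))) h2 -h1 ltnn.
by have := h; rewrite -[X in (X < _)%N]/(val (Ordinal (leq_trans h b1))) h1 -h2 ltnn.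
Qed.

(** Lattice words are grouped by their final shape, which exists and is unique. *)
Lemma sum_SYT_words n N (t : rat) : t != 0 ->
  \sum_(la : partition_of n | (part1 la <= N)%N) (num_SYT la)%:R * t ^+ odd_rows la
  = \sum_(W : {ffun 'I_n -> 'I_N} | lattice_word W)
      \prod_(q < N) (if odd q then t^-1 else t) ^+ occ W n q.
Proof.
move=> t0.
transitivity (\sum_(la : partition_of n | (part1 la <= N)%N)
   \sum_(W : {ffun 'I_n -> 'I_N} | lattice_word W && has_shape la W)
      \prod_(q < N) (if odd q then t^-1 else t) ^+ occ W n q).
  apply: eq_bigr => la hla; rewrite (card_SYT_words hla) -sum1_card natr_sum mulr_suml.
  rewrite (eq_bigl _ _ (fun W => in_set _ W)); apply: eq_bigr => W /andP[_ sh].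
  by rewrite mul1r -(has_shape_weight t0 sh hla).
rewrite (exchange_big_dep (fun W : {ffun 'I_n -> 'I_N} => lattice_word W)) /=; last first.
  by move=> la W _ /andP[].
apply: eq_bigr => W lW; have [la /andP[sh hla]] := lattice_word_shape lW.
rewrite (big_pred1 la) // => mu /=; rewrite lW /=; apply/andP/eqP => [[h1 h2]|->//].
exact: has_shape_unique h2 h1 sh hla.
Qed.
(** * The sign-reversing involution *)

Section IntervalSystems.

Variables (w e : nat).
Local Notation m := (w + e)%N.
Local Notation N := (w + e + w)%N.
Implicit Types (s : 'S_N) (i j : 'I_m) (x : 'I_N).

(** [s] comes from the Leibniz expansion of a bialternant. An interval runs from the column of z_i
    (or t), its left end [upper], to the column of 1/z_i. Exponents will decrease along the columns,
    so [valid] says that every z_i has positive total exponent, which is when the functional does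
    not kill the term. *)
Definition upper s i : nat := s (lshift w i).

(* The intervals of index at least [w] are unbounded: [N] exceeds every value of [s]. *)
Definition lower s i : nat :=
  if split i is inl j then s (rshift m j) else N.

Definition valid s := [forall i, upper s i < lower s i]%N.

Definition cover s x : {set 'I_m} := [set i | upper s i <= x < lower s i]%N.

Definition disjoint_intervals s := [forall x, #|cover s x| <= 1]%N.

(** The choice depends only on the cardinals of the covers and on one cover, which the swap
    preserves; hence swapping twice picks the same pair. *)
Definition overlap s : option ('I_m * 'I_m) :=
  if [pick x | 1 < #|cover s x|]%N is Some x then
    [pick ij : 'I_m * 'I_m |
      [&& ij.1 \in cover s x, ij.2 \in cover s x & ij.1 != ij.2]]
  else None.

Definition swap_uppers s : 'S_N :=
  if valid s then
    if overlap s is Some ij then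
      (tperm (lshift w ij.1) (lshift w ij.2) * s)%g
    else s
  else s.

Lemma upper_swap s i j k :
  upper (tperm (lshift w i) (lshift w j) * s)%g k = upper s (tperm i j k).
Proof.
rewrite /upper permM; congr (_ (s _)).
by rewrite !permE /= !(inj_eq (@lshift_inj _ _)); do 2![case: ifP => //].
Qed.

Lemma lower_swap s i j k :
  lower (tperm (lshift w i) (lshift w j) * s)%g k = lower s k.
Proof.
rewrite /lower; case: (split k) => // a; rewrite permM tpermD //;
  by rewrite eq_lrshift.
Qed.

(** Intervals open at [x] are those begun minus those ended, a number that does not depend on how
    the ends are paired. *)
Lemma card_cover s x : valid s ->
  (#|cover s x| + #|[set i | lower s i <= x]%N| = #|[set i | upper s i <= x]%N|)%N.
Proof.
move=> /forallP vs.
have sub : [set i | lower s i <= x]%N \subset [set i | upper s i <= x]%N.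
  by apply/subsetP => i; rewrite !inE => h; apply: leq_trans h; apply/ltnW.
have -> : cover s x = [set i | upper s i <= x]%N :\: [set i | lower s i <= x]%N.
  by apply/setP => i; rewrite !inE -ltnNge andbC.
by rewrite cardsDS // subnK // subset_leq_card.
Qed.

(** Two intervals through a common point [x] still contain [x] after exchanging their left ends, so
    the new system is valid and offers the same pair. *)
Lemma swap_uppersP s : valid s -> ~~ disjoint_intervals s ->
  exists2 ij : 'I_m * 'I_m, ij.1 != ij.2 &
    [/\ swap_uppers s = (tperm (lshift w ij.1) (lshift w ij.2) * s)%g,
        valid (swap_uppers s), disjoint_intervals (swap_uppers s) = false &
        overlap (swap_uppers s) = Some ij].
Proof.
move=> vs; rewrite negb_forall => /existsP[x0]; rewrite -ltnNge => cx0.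
rewrite /swap_uppers vs.
case E : (overlap s) => [[i j]|]; last first.
  move: E; rewrite /overlap; case: pickP => [x cx|/(_ x0)]; last by rewrite cx0.
  case: pickP => // nop _; have /card_gt1P[a [b [aX bX ab]]] := cx.
  by move: (nop (a, b)); rewrite /= aX bX ab.
have [x cx] : exists2 x, [pick x | 1 < #|cover s x|]%N = Some x &
   [/\ i \in cover s x, j \in cover s x & i != j].
  move: E; rewrite /overlap; case: pickP => // x cx; case: pickP => // ij.
  by move=> /and3P[h1 h2 h3] [E]; exists x => //; move: h1 h2 h3; rewrite E.
move=> [ic jc nij]; exists (i, j) => //=.
set s' := (tperm _ _ * s)%g.
have upE := upper_swap s i j; have loE := lower_swap s i j.
have ic' := ic; have jc' := jc; move: ic' jc'; rewrite !inE => /andP[iu il] /andP[ju jl].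
have vs' : valid s'.
  apply/forallP => k; rewrite upE loE.
  case: tpermP => [->|->|_ _]; last by apply: (forallP vs).
    exact: leq_ltn_trans ju il.
  exact: leq_ltn_trans iu jl.
have covE y : #|cover s' y| = #|cover s y|.
  apply/eqP; rewrite -(eqn_add2r #|[set k | lower s k <= y]%N|) card_cover //.
  have -> : [set k | lower s k <= y]%N = [set k | lower s' k <= y]%N.
    by apply/setP => k; rewrite !inE loE.
  rewrite card_cover //; apply/eqP.
  rewrite -!sum1_card [RHS](reindex_inj (@perm_inj _ (tperm i j))).
  by apply: eq_bigl => k; rewrite !inE upE.
have cov' : cover s' x = cover s x.
  apply/setP => k; rewrite !inE upE loE; case: tpermP => [->|->|//].
    by rewrite iu il ju.
  by rewrite ju jl iu.
split=> //.
  apply/negbTE/forallPn; exists x0; by rewrite -ltnNge covE.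
move: E; rewrite /overlap (eq_pick (fun y => congr1 (leq 2) (covE y))) cx.
by rewrite cov'.
Qed.

Lemma swap_uppersK : involutive swap_uppers.
Proof.
move=> s; case vs : (valid s); last by rewrite /swap_uppers vs vs.
case ds : (disjoint_intervals s).
  have -> : swap_uppers s = s; last rewrite /swap_uppers vs.
    rewrite /swap_uppers vs /overlap; case: pickP => // x.
    by rewrite ltnNge (forallP ds).
  rewrite /overlap; case: pickP => // x.
  by rewrite ltnNge (forallP ds).
have [[i j] /= nij [E vs' _ ov]] := swap_uppersP vs (negbT ds).
by rewrite {1}/swap_uppers vs' ov E mulgA tperm2 mul1g.
Qed.

(** At most one interval is open at a time, so among the first [y] columns the left ends exceed the
    right ends by 0 or 1. Together they number [y], so there are [uphalf y] left ends, which
    therefore sit at the even columns. *)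
Lemma disjoint_intervals_parity s : valid s -> disjoint_intervals s ->
  forall p : 'I_N, odd (s p) = (m <= p)%N.
Proof.
move=> vs /forallP ds p.
pose A y := #|[set i : 'I_m | s (lshift w i) < y]%N|.
pose B y := #|[set j : 'I_w | s (rshift m j) < y]%N|.
have sumAB y : (y <= N)%N -> (A y + B y = y)%N.
  move=> yN; rewrite /A /B -!sum1_card.
  under eq_bigl do rewrite inE; under [X in (_ + X)%N]eq_bigl do rewrite inE.
  rewrite -(big_split_ord addn (fun p => s p < y)%N (fun=> 1%N)) /=.
  rewrite -[RHS]card_ord -sum1_card (big_ord_widen N (fun=> 1%N)) //.
  by rewrite [RHS](reindex_inj (@perm_inj _ s)).
have diff y : (y <= N)%N -> (B y <= A y <= (B y).+1)%N.
  case: y => [_|y yN].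
    by rewrite /A /B; do 2![rewrite (eq_card0 (_ : _ =i pred0)) //; last by move=> ?; rewrite !inE].
  have := card_cover (Ordinal yN) vs; have := ds (Ordinal yN).
  (* Unbounded intervals are not counted here, since they end at [N > y]. *)
  have -> : #|[set i | lower s i <= Ordinal yN]%N| = B y.+1.
    rewrite /B -!sum1_card.
    under eq_bigl do rewrite inE; under [RHS]eq_bigl do rewrite inE.
    rewrite (big_split_ord addn (fun i => lower s i <= y)%N (fun=> 1%N)) /=.
    rewrite [X in (_ + X)%N]big_pred0 ?addn0; last first.
      by move=> k; rewrite /lower (unsplitK (inr k)) leqNgt yN.
    by apply: eq_bigl => k; rewrite /lower (unsplitK (inl k)).
  have -> : #|[set i | upper s i <= Ordinal yN]%N| = A y.+1 by [].
  by move=> h1 <-; rewrite leq_addl /= -(add1n (B _)) leq_add2r.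
have AE y : (y <= N)%N -> A y = uphalf y.
  by move=> yN; move: (sumAB y yN) (diff y yN) => h; rewrite uphalf_half; lia.
(* [A] jumps at the column [s p] exactly when [p] indexes a left end. *)
have step : A (s p).+1 = (A (s p) + (p < m))%N.
  have -> : A (s p).+1 = (A (s p) + #|[set i : 'I_m | s (lshift w i) == s p]|)%N.
    rewrite /A -!sum1_card !(big_mkcond (fun i => i \in _)) -big_split /=.
    apply: eq_bigr => i _; rewrite !inE ltnS leq_eqVlt -val_eqE /=.
    by case: ltngtP.
  congr addn; case: (splitP p) => [i pi|k pk].
    transitivity #|[set i]|; last by rewrite cards1.
    congr #|pred_of_set _|; apply/setP => k; rewrite !inE.
    rewrite (inj_eq perm_inj) -!val_eqE /= pi.
    by [].
  apply: eq_card0 => i; rewrite !inE (inj_eq perm_inj) -val_eqE /= pk.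
  by have := ltn_ord i; lia.
move: step; rewrite !AE ?(ltnW (ltn_ord _)) //=.
by rewrite uphalf_half; case: (odd _) => //=; lia.
Qed.

(* Swapping the upper ends of two overlapping intervals changes the sign of the permutation
   and nothing else, so only systems of disjoint intervals contribute. *)
Lemma valid_sum (al be : 'I_N -> rat) :
  \sum_(s : 'S_N | valid s) (-1) ^+ s
     * ((\prod_(i < m) al (s (lshift w i))) * \prod_(j < w) be (s (rshift m j)))
  = (\sum_(s : 'S_N | valid s && disjoint_intervals s) (-1) ^+ s)
     * \prod_(q < N) (if odd q then be q else al q).
Proof.
rewrite (bigID disjoint_intervals) /= [X in _ + X](_ : _ = 0) ?addr0.
  rewrite mulr_suml; apply: eq_bigr => s /andP[vs ds]; congr (_ * _).
  rewrite [RHS](reindex_inj (@perm_inj _ s)) /= [RHS]big_split_ord /=.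
  congr (_ * _); apply: eq_bigr => i _.
    by rewrite disjoint_intervals_parity //= leqNgt ltn_ord.
  by rewrite disjoint_intervals_parity //= leq_addr.
set S := (X in X = 0); suff : S = - S by lra.
rewrite {1}/S (reindex_inj (inv_inj swap_uppersK)) /= -sumrN.
have cond s : valid (swap_uppers s) && ~~ disjoint_intervals (swap_uppers s)
    = (valid s && ~~ disjoint_intervals s).
  have half s' : valid s' && ~~ disjoint_intervals s' ->
      valid (swap_uppers s') && ~~ disjoint_intervals (swap_uppers s').
    by move=> /andP[vs ds]; have [ij _ [_ -> -> _]] := swap_uppersP vs ds.
  by apply/idP/idP => [/half|/half //]; rewrite swap_uppersK.
apply: eq_big => // s; rewrite cond => /andP[vs ds].
have [[i j] /= nij [-> _ _ _]] := swap_uppersP vs ds.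
rewrite odd_permM odd_tperm (inj_eq (@lshift_inj _ _)) nij signr_addb -!mulNr expr1.
rewrite mulN1r; congr (_ * (_ * _)).
  rewrite [RHS](reindex_inj (@perm_inj _ (tperm i j))); apply: eq_bigr => k _.
  by congr al; apply: val_inj; apply: upper_swap.
apply: eq_bigr => k _; rewrite permM tpermD //; by rewrite eq_lrshift.
Qed.

End IntervalSystems.
(** * Vandermonde determinants and Andreief's identity *)

Definition vdm n (f : 'I_n -> rat) : rat :=
  \prod_(i < n) \prod_(j < n | (i < j)%N) (f j - f i).

Lemma vdmE n (f : 'I_n -> rat) : vdm f = \det (\matrix_(i < n, j < n) f j ^+ i).
Proof.
have -> : \matrix_(i < n, j < n) f j ^+ i = Vandermonde n (\row_j f j).
  by apply/matrixP => i j; rewrite !mxE.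
by rewrite det_Vandermonde; do 2![apply: eq_bigr => ? _]; rewrite !mxE.
Qed.

Lemma eq_vdm n (f g : 'I_n -> rat) : f =1 g -> vdm f = vdm g.
Proof. by move=> h; apply: eq_bigr => i _; apply: eq_bigr => j _; rewrite !h. Qed.

Lemma vdm_sum n (f : 'I_n -> rat) :
  vdm f = \sum_(s : 'S_n) (-1) ^+ s * \prod_i f i ^+ s i.
Proof.
rewrite vdmE -det_tr; apply: eq_bigr => s _; congr (_ * _).
by apply: eq_bigr => i _; rewrite !mxE.
Qed.

Lemma vdm_perm n (f : 'I_n -> rat) (s : 'S_n) :
  vdm (fun j => f (s j)) = (-1) ^+ s * vdm f.
Proof.
rewrite !vdmE mulrC -odd_permV -det_perm -det_mulmx -col_permE.
by congr (\det _); apply/matrixP => i j; rewrite !mxE.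
Qed.

Lemma vdm_split a b (f : 'I_(a + b) -> rat) :
  vdm f = vdm (fun i => f (lshift b i)) * vdm (fun j => f (rshift a j))
          * \prod_(i < a) \prod_(j < b) (f (rshift a j) - f (lshift b i)).
Proof.
rewrite /vdm big_split_ord /= mulrAC; congr (_ * _).
  rewrite -big_split; apply: eq_bigr => i _; rewrite big_split_ord /=.
  congr (_ * _); apply: eq_bigl => j.
  by rewrite (leq_trans (ltn_ord i)) // leq_addr.
apply: eq_bigr => i _; rewrite big_split_ord /= big_pred0 ?mul1r.
  by apply: eq_bigl => j; rewrite ltn_add2l.
by move=> j; rewrite ltnNge ltnW // (leq_trans (ltn_ord j)) // leq_addr.
Qed.

Lemma double_prod n (f : 'I_n -> 'I_n -> rat) :
  \prod_(i < n) \prod_(j < n) f i j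
  = (\prod_(i < n) f i i) * \prod_(i < n) \prod_(j < n | (i < j)%N) (f i j * f j i).
Proof.
under [X in _ = _ * X]eq_bigr do rewrite big_split /=.
rewrite big_split /= [X in _ * (_ * X)](exchange_big_dep xpredT) //=.
rewrite -!big_split; apply: eq_bigr => i _ /=.
rewrite (bigD1 i) //=; congr (_ * _).
rewrite (bigID (fun j : 'I_n => i < j)%N) /=; congr (_ * _); apply: eq_bigl => j.
  by rewrite -val_eqE /=; case: ltngtP.
by rewrite -leqNgt [in RHS]ltn_neqAle.
Qed.

(* The variables of the bialternants: [z_0 .. z_(w-1)], then [e] copies of [t], then the
   inverses of the [z_j]. *)
Definition spectrum w e (t : rat) (z : 'I_w -> rat) (p : 'I_(w + e + w)) : rat :=
  match split p with
  | inl a => match split a with inl j => z j | inr _ => t end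
  | inr j => (z j)^-1
  end.

Lemma spectrum_l w e t z (a : 'I_(w + e)) :
  @spectrum w e t z (lshift w a) = match split a with inl j => z j | inr _ => t end.
Proof. by rewrite /spectrum (unsplitK (inl a)). Qed.

Lemma spectrum_ll w e t z j : @spectrum w e t z (lshift w (lshift e j)) = z j.
Proof. by rewrite spectrum_l (unsplitK (inl j)). Qed.

Lemma spectrum_lr w e t z j : @spectrum w e t z (lshift w (rshift w j)) = t.
Proof. by rewrite spectrum_l (unsplitK (inr j)). Qed.

Lemma spectrum_r w e t z j : @spectrum w e t z (rshift (w + e) j) = (z j)^-1.
Proof. by rewrite /spectrum (unsplitK (inr j)). Qed.

(** For two pairs the four differences multiply to [- (y_j - y_i)^2], and [t - z] times [1/z - t] is
    [- (1 - t y + t^2)]. With [e <= 1] there is no vanishing difference between two copies of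
    [t]. *)
Lemma vdm_spectrum w e t : (e <= 1)%N -> exists2 k : rat, k != 0 & forall z : 'I_w -> rat,
  (forall j, z j != 0) ->
  vdm (@spectrum w e t z)
  = k * \prod_(j < w) ((z j - (z j)^-1) * (1 - t * (z j + (z j)^-1) + t ^+ 2) ^+ e)
      * vdm (fun j => z j + (z j)^-1) ^+ 2.
Proof.
move=> e1; exists (vdm (fun _ : 'I_e => t) * (\prod_(i < w) ((-1) * (-1) ^+ e))
        * \prod_(i < w) \prod_(j < w | (i < j)%N) -1); last move=> z z0.
  have -> : vdm (fun _ : 'I_e => t) = 1.
    by apply: big1 => i _; apply: big1 => j ij; have := ltn_ord j; lia.
  by rewrite !mulf_neq0 ?oner_eq0 //; apply/prodf_neq0 => i _;
    rewrite ?mulf_neq0 ?signr_eq0 //; apply/prodf_neq0.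
rewrite !vdm_split /= big_split_ord /=.
have -> : vdm (fun i => spectrum t z (lshift w (lshift e i))) = vdm z.
  by apply: eq_vdm => j; rewrite spectrum_ll.
have -> : vdm (fun i : 'I_e => spectrum t z (lshift w (rshift w i))) = vdm (fun _ : 'I_e => t).
  by apply: eq_vdm => j; rewrite spectrum_lr.
have -> : vdm (fun j : 'I_w => spectrum t z (rshift (w + e) j)) = vdm (fun j => (z j)^-1).
  by apply: eq_vdm => j; rewrite spectrum_r.
under [X in _ * (X * _)]eq_bigr do under eq_bigr do rewrite spectrum_ll spectrum_r.
rewrite double_prod.
set P1 := \prod_(i < w) \prod_(j < e) _.
set P2 := \prod_(i < e) \prod_(j < w) _.
have P12 : P1 * P2 = \prod_(j < w)
    ((-1) ^+ e * (1 - t * (z j + (z j)^-1) + t ^+ 2) ^+ e).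
  rewrite /P1 /P2 [X in _ * X]exchange_big -big_split; apply: eq_bigr => i _ /=.
  rewrite -big_split /= -exprMn.
  under eq_bigr do rewrite !spectrum_lr spectrum_ll spectrum_r.
  rewrite prodr_const card_ord; congr (_ ^+ _); field; exact: z0.
have V2 : vdm z * vdm (fun j => (z j)^-1)
    * \prod_(i < w) \prod_(j < w | (i < j)%N)
        (((z j)^-1 - z i) * ((z i)^-1 - z j))
    = (\prod_(i < w) \prod_(j < w | (i < j)%N) -1)
      * vdm (fun j => z j + (z j)^-1) ^+ 2.
  rewrite /vdm -!prodrXl -!big_split; apply: eq_bigr => i _.
  rewrite -prodrXl -!big_split; apply: eq_bigr => j _ /=.
  by field; rewrite !z0.
transitivity (vdm (fun _ : 'I_e => t) * (P1 * P2) * (\prod_(i < w) ((z i)^-1 - z i))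
  * (vdm z * vdm (fun j => (z j)^-1)
    * \prod_(i < w) \prod_(j < w | (i < j)%N) (((z j)^-1 - z i) * ((z i)^-1 - z j)))).
  by ring.
rewrite P12 V2.
have M : (\prod_(j < w) ((-1) ^+ e * (1 - t * (z j + (z j)^-1) + t ^+ 2) ^+ e))
    * (\prod_(i < w) ((z i)^-1 - z i))
  = (\prod_(i < w) ((-1) * (-1) ^+ e))
    * \prod_(j < w) ((z j - (z j)^-1) * (1 - t * (z j + (z j)^-1) + t ^+ 2) ^+ e).
  rewrite -!big_split; apply: eq_bigr => i _ /=.
  move: (z i)^-1 => c; move: ((1 - t * (z i + c) + t ^+ 2) ^+ e) => b.
  by move: ((-1) ^+ e) => a; ring.
by rewrite -[_ * _ * \prod_(i < w) _]mulrA M; ring.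
Qed.

Lemma bialternant_delta N : exists2 k : rat, k != 0 & forall x : 'I_N -> rat,
  bialternant x (fun q => N - q.+1)%N = k * vdm x.
Proof.
exists ((-1) ^+ perm (@rev_ord_inj N)) => [|x]; first by rewrite signr_eq0.
rewrite vdmE -det_tr mulrC -odd_permV -det_perm -det_mulmx -col_permE.
by congr (\det _); apply/matrixP => p q; rewrite !mxE permE.
Qed.

(** The points 1, ..., 2D+1 have an invertible Vandermonde matrix, so any linear functional on
    Laurent polynomials with degrees from -D to D is a weighted sum of evaluations. [T d] prescribes
    the value in degree [d - D]. *)
Lemma moment_weights D (T : nat -> rat) :
  exists om : 'I_(2 * D).+1 -> rat, forall a b, (a <= D)%N -> (b <= D)%N ->
    \sum_c om c * ((c.+1)%:R ^+ a * (c.+1)%:R^-1 ^+ b) = T (D + a - b)%N.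
Proof.
set M := (2 * D).+1.
pose A : 'M[rat]_M := \matrix_(i, j) (j.+1)%:R ^+ i.
have Au : A \in unitmx.
  rewrite unitmxE unitfE -(vdmE (fun j : 'I_M => (j.+1)%:R)) /vdm.
  apply/prodf_neq0 => i _; apply/prodf_neq0 => j ij.
  by rewrite subr_eq0 eqr_nat eqSS gtn_eqF.
pose v : 'cV[rat]_M := invmx A *m \col_i T i.
(* The power [D] of the point shifts the degrees -D, ..., D to 0, ..., 2D. *)
exists (fun c => v c 0 * (c.+1)%:R ^+ D) => a b aD bD.
have iM : (D + a - b < M)%N by rewrite /M; lia.
have : (A *m v) (Ordinal iM) 0 = T (D + a - b)%N by rewrite mulKVmx // mxE.
rewrite mxE => <-; apply: eq_bigr => c _; rewrite mxE [RHS]mulrC -mulrA.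
congr (_ * _); rewrite mulrA -exprD -{1}(subnK (_ : b <= D + a)%N); last by lia.
by rewrite exprD exprVn mulfK ?mxE // expf_neq0 // pnatr_eq0.
Qed.

(** Compares the coefficients of X^n in a product of exponential series, truncated at [B > n] so
    that the exponents range over a finite type. *)
Lemma exp_sum_multinomial w B n (a : 'I_w -> rat) : (n < B)%N ->
  (\sum_j a j) ^+ n
  = \sum_(u : {ffun 'I_w -> 'I_B} | (\sum_j u j == n)%N)
      n`!%:R / (\prod_j ((u j)`!)%:R) * \prod_j a j ^+ u j.
Proof.
move=> nB.
have fact0 k : (k`!)%:R != 0 :> rat by rewrite pnatr_eq0 -lt0n fact_gt0.
pose E w' (b : 'I_w' -> rat) := \prod_j \poly_(k < B) (b j ^+ k / (k`!)%:R).
have coefE w' (b : 'I_w' -> rat) k : (k < B)%N -> (E w' b)`_k = (\sum_j b j) ^+ k / (k`!)%:R.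
  rewrite /E; elim: w' => [|w' IH] in b k *; move=> kB.
    by rewrite !big_ord0 coef1 expr0n; case: k {kB} => [|k]; rewrite ?divr1 ?mul0r.
  rewrite !big_ord_recr /= addrC coefM exprDn mulr_suml; apply: eq_bigr => i _.
  have ik : (i <= k)%N by rewrite -ltnS.
  rewrite IH ?coef_poly; last by apply: leq_ltn_trans kB.
  rewrite (leq_ltn_trans (leq_subr _ _) kB) -(bin_fact ik) !natrM.
  by field; rewrite !fact0 pnatr_eq0 -lt0n bin_gt0.
apply: (mulIf (invr_neq0 (fact0 n))); rewrite -coefE // /E.
under eq_bigr do rewrite poly_def.
rewrite bigA_distr_bigA /= coef_sum mulr_suml [RHS]big_mkcond; apply: eq_bigr => u _.
rewrite scaler_prod prodrXr coefZ coefXn eq_sym.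
case: eqP => _; last by rewrite mulr0.
by rewrite mulr1 prodf_div; field; rewrite fact0; apply/prodf_neq0 => j _.
Qed.

Lemma multinomialE n (s : seq nat) : sumn s = n ->
  (multinomial n s)%:R = n`!%:R / \prod_(a <- s) (a`!)%:R :> rat.
Proof.
move=> <-; rewrite /multinomial.
have dv : (\prod_(a <- s) a`! %| (sumn s)`!)%N.
  elim: s => [|a s IH]; first by rewrite big_nil.
  rewrite big_cons /= -(bin_fact (leq_addr (sumn s) a)) addKn.
  by rewrite dvdn_mull // dvdn_mul.
have nz : (\prod_(a <- s) a`!)%:R != 0 :> rat.
  by rewrite pnatr_eq0 -lt0n prodn_gt0 // => a; rewrite fact_gt0.
rewrite -[in RHS](divnK dv) natrM -natr_prod mulfK //.
Qed.

Section Andreief.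

Variables (C : finType) (w : nat) (g : 'I_w -> C -> rat) (y : C -> rat).

(** Relabelling [c] by a permutation of the expanded determinant changes [vdm] by the same sign, so
    all w! terms equal the diagonal one, [S]. In [S] the power and [vdm] are expanded, and the sum
    over [c] factors over the rows of a new determinant. *)
Lemma andreief B n : (n < B)%N ->
  \sum_(c : {ffun 'I_w -> C}) \det (\matrix_(i < w, j < w) g i (c j))
     * (vdm (fun j => y (c j)) * (\sum_j y (c j)) ^+ n)
  = w`!%:R * \sum_(u : {ffun 'I_w -> 'I_B} | (\sum_j u j == n)%N)
      n`!%:R / (\prod_j ((u j)`!)%:R)
      * \det (\matrix_(i < w, j < w) \sum_c g i c * y c ^+ (u i + j)).
Proof.
move=> nB; pose S := \sum_(c : {ffun 'I_w -> C}) (\prod_i g i (c i))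
     * (vdm (fun j => y (c j)) * (\sum_j y (c j)) ^+ n).
transitivity (\sum_(s : 'S_w) S).
  rewrite /determinant; under eq_bigr do rewrite mulr_suml.
  rewrite exchange_big /=; apply: eq_bigr => s _.
  pose h (r : 'S_w) (c : {ffun 'I_w -> C}) := [ffun i => c (r i)].
  have hK : cancel (h s^-1%g) (h s).
    by move=> c; apply/ffunP => i; rewrite !ffunE permK.
  have Kh : cancel (h s) (h s^-1%g).
    by move=> c; apply/ffunP => i; rewrite !ffunE permKV.
  rewrite (reindex (h s^-1%g)) /=; last by exists (h s) => ? _.
  apply: eq_bigr => c _; rewrite !mulrA; congr (_ * _); last first.
    congr (_ ^+ _); rewrite (reindex_inj (@perm_inj _ s)) /=.
    by apply: eq_bigr => j _; rewrite ffunE permK.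
  rewrite (eq_vdm (g := fun j => y (c (s^-1%g j)))); last by move=> j; rewrite ffunE.
  rewrite (vdm_perm (fun j => y (c j))) odd_permV mulrACA.
  rewrite -signr_addb addbb mul1r; congr (_ * _).
  by apply: eq_bigr => i _; rewrite mxE ffunE permK.
rewrite sumr_const card_Sn -[LHS]mulr_natl; congr (_ * _).
rewrite /S; under eq_bigr => c _.
  rewrite (exp_sum_multinomial _ nB) vdm_sum mulr_sumr mulr_sumr; over.
rewrite exchange_big /=; apply: eq_bigr => u _.
rewrite /determinant mulr_sumr; under eq_bigr => c _ do rewrite mulr_suml mulr_sumr.
rewrite exchange_big /=; apply: eq_bigr => s _.
rewrite [X in _ = _ * (_ * X)](eq_bigr (fun i => \sum_c g i c * y c ^+ (u i + s i)));
  last by move=> i _; rewrite mxE.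
rewrite bigA_distr_bigA !mulr_sumr; apply: eq_bigr => c _.
transitivity (n`!%:R / (\prod_j ((u j)`!)%:R) * ((-1) ^+ s *
  ((\prod_i g i (c i)) * ((\prod_i y (c i) ^+ u i) * \prod_i y (c i) ^+ s i)))).
  move: (n`!%:R / _) ((-1) ^+ s) (\prod_i g i (c i)) => m1 m2 m3.
  move: (\prod_i y (c i) ^+ s i) (\prod_i y (c i) ^+ u i) => m4 m5; ring.
rewrite -!big_split; congr (_ * (_ * _)); apply: eq_bigr => i _ /=.
by rewrite exprD.
Qed.
End Andreief.
(** * Ballot numbers *)

(** Counts the paths of [m] steps up or down by 1 from 0 to height [h] that never go below 0. *)
Fixpoint ballot (m h : nat) : nat :=
  if m is m'.+1 then
    ((if h is h'.+1 then ballot m' h' else 0) + ballot m' h.+1)%N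
  else (h == 0)%N.

Lemma ballot_gt m h : (m < h)%N -> ballot m h = 0%N.
Proof.
elim: m h => [|m IH] [|h] //= mh; rewrite !IH //; lia.
Qed.

Lemma ballot_diag m : ballot m m = 1%N.
Proof. by elim: m => //= m ->; rewrite ballot_gt. Qed.

Lemma ballot_odd m h : odd (m + h) -> ballot m h = 0%N.
Proof.
elim: m h => [|m IH] [|h] //= o; rewrite !IH //; move: o; rewrite ?addn0 ?addn1 ?addnS //=;
  by rewrite ?negbK.
Qed.

(** The formula of the reflection principle, with [s] the number of down steps; checked by the
    recurrence and Pascal's rule. *)
Lemma ballotE h s : (ballot (h + 2 * s) h)%:R
  = 'C(h + 2 * s, s)%:R - (if s is s'.+1 then 'C(h + 2 * s, s')%:R else 0) :> rat.
Proof.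
move Em : (h + 2 * s)%N => m; elim: m => [|m IH] in h s Em *.
  have [-> ->] : h = 0%N /\ s = 0%N by lia.
  by rewrite subr0.
have pascal a : 'C(m.+1, a)%:R = 'C(m, a)%:R + (if a is a'.+1 then 'C(m, a')%:R else 0) :> rat.
  by case: a => [|a]; rewrite ?bin0 ?addr0 // binS natrD.
case: h Em => [|h] Em /=.
  case: s Em => [|s] Em; first by lia.
  rewrite add0n (IH 1%N s); last by lia.
  (* Here [m = 2s + 1], and symmetry identifies the two middle binomials. *)
  rewrite !pascal -(@bin_sub m s.+1); last by lia.
  have -> : (m - s.+1 = s)%N by lia.
  by case: s {Em} => [|s] //=; ring.
rewrite natrD (IH h s); last by lia.
case: s Em => [|s] Em.
  by rewrite ballot_gt ?bin0; [ring | lia].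
rewrite (IH h.+2 s); last by lia.
rewrite !pascal; by case: s {Em} => [|s] /=; ring.
Qed.

Lemma Cat_half m : Cat (m%:R / 2) = (ballot m 0)%:R.
Proof.
have [o|] := boolP (odd m).
  rewrite ballot_odd ?addn0 // /Cat; case: ifP => // /natrP[k E].
  suff : m = (k * 2)%N by move=> Ek; move: o; rewrite Ek oddM andbF.
  by apply/eqP; rewrite -(eqr_nat rat) natrM -E divfK.
move=> /even_halfK Em; move: (m./2) Em => s; rewrite -mul2n => <-.
have -> : (2 * s)%:R / 2 = s%:R :> rat by rewrite natrM mulrC mulKf.
rewrite /Cat natr_nat natrK (ballotE 0 s) add0n.
case: s => [|s]; first by rewrite subr0 divr1.
(* [(s+1) C(2s+2, s+1) = (s+2) C(2s+2, s)] turns the difference of binomials into the Catalan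
   quotient. *)
have := congr1 (fun k => k%:R : rat) (mul_bin_left (2 * s.+1) s).
have -> : (2 * s.+1 - s = s.+2)%N by lia.
rewrite !natrM => h.
have s2 : s.+2%:R != 0 :> rat by rewrite pnatr_eq0.
apply: (mulIf s2); rewrite mulfVK // mulrBl [X in _ - X]mulrC -h.
rewrite -[s.+2%:R]natr1; ring.
Qed.

(** An integral argument [s >= 0] is the number of down steps. A negative one means [m < h] and a
    non-integral one the wrong parity or [m < h]; then both sides vanish. *)
Lemma F_half m h : F m ((m%:R - h%:R) / 2) = (ballot m h)%:R.
Proof.
rewrite /F; case: ifPn => [/intrP[s E]|nint].
  have Em : m%:R = h%:R + 2 * s%:~R :> rat by rewrite -E; field.
  rewrite E intrKfloor; case: s E Em => k E Em /=.
    have -> : m = (h + 2 * k)%N by apply/eqP; rewrite -(eqr_nat rat) Em natrD natrM.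
    rewrite ballotE; case: k {E Em} => [|k]; first by rewrite subr0.
    by rewrite (_ : Posz k.+1 - 1 = Posz k) //; lia.
  have mh : (m < h)%N.
    by rewrite -(ltr_nat rat) Em NegzE mulrNz; have : (0 : rat) < k.+1%:R by []; lra.
  by rewrite ballot_gt // (_ : Negz k - 1 = Negz k.+1) //; lia.
have [mh|hm] := ltnP m h; first by rewrite ballot_gt.
rewrite ballot_odd //; apply: contraR nint => ev.
have -> : m = (h + 2 * (m - h)./2)%N.
  by rewrite mul2n even_halfK ?subnKC // oddB // -oddD.
by rewrite natrD addrC addKr natrM mulrC mulKf.
Qed.
(** * Moments of the functional *)

Lemma det_poly_eval w (p : 'I_w -> {poly rat}) (a y : 'I_w -> rat) :
  (forall i, size (p i) <= w)%N ->
  \det (\matrix_(i < w, j < w) (a j * (p i).[y j]))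
  = \det (\matrix_(i < w, j < w) (p i)`_j) * ((\prod_j a j) * vdm y).
Proof.
move=> sp; rewrite vdmE.
have -> : \prod_j a j = \det (diag_mx (\row_j a j)).
  by rewrite det_diag; apply: eq_bigr => j _; rewrite mxE.
rewrite [X in _ * X]mulrC -!det_mulmx; congr (\det _); apply/matrixP => i j.
rewrite mulmxA mul_mx_diag !mxE mulrC; congr (_ * _).
rewrite (horner_coef_wide _ (sp i)); apply: eq_bigr => k _.
by rewrite !mxE.
Qed.

Lemma sum_prod_ffun (C : finType) w (G : 'I_w -> C -> rat) :
  \sum_(c : {ffun 'I_w -> C}) \prod_j G j (c j) = \prod_j \sum_c G j c.
Proof. by rewrite bigA_distr_bigA. Qed.

(** A signed count that is never evaluated: it only enters a constant fixed by the case n = 0. *)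
Definition disjoint_sign_sum w e : rat :=
  \sum_(s : 'S_(w + e + w) | valid s && disjoint_intervals s) (-1) ^+ s.

(** Second kind, normalised as U_h(y/2), so that y = z + 1/z gives the quotient of z^(h+1) -
    z^(-h-1) by z - 1/z. *)
Fixpoint chebyshev (h : nat) : {poly rat} :=
  if h is h1.+1 then
    if h1 is h2.+1 then 'X * chebyshev h1 - chebyshev h2 else 'X
  else 1.

Lemma size_chebyshev h : (size (chebyshev h) <= h.+1)%N.
Proof.
suff : (size (chebyshev h) <= h.+1)%N /\ (size (chebyshev h.+1) <= h.+2)%N by case.
elim: h => [|h [IH1 IH2]]; first by rewrite size_poly1 size_polyX.
split=> //; change (chebyshev h.+2) with ('X * chebyshev h.+1 - chebyshev h).
rewrite (leq_trans (size_polyD _ _)) // size_polyN geq_max.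
apply/andP; split; last by apply: leq_trans IH1 _; lia.
apply: leq_trans (size_polyMleq _ _) _; rewrite size_polyX; lia.
Qed.

(** [odd_term] and [even_term] are the two right-hand sides, with [Cat] and [F] written as ballot
    numbers and indices from 0. *)
Definition odd_term w n k : rat :=
  \sum_(u : {ffun 'I_w -> 'I_n.+1} | (k + \sum_j u j == n)%N)
    n`!%:R / (k`!%:R * \prod_j ((u j)`!)%:R)
    * \det (\matrix_(i < w, j < w) (ballot (u i + i + j) 0)%:R).

Definition even_term w n k : rat :=
  \sum_(u : {ffun 'I_w -> 'I_n.+1} | (\sum_j u j == n)%N)
    n`!%:R / (\prod_j ((u j)`!)%:R)
    * \det (\matrix_(i < w, j < w) (ballot (u i + j) (i + k * (i.+1 == w)))%:R).

Section Moments.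

Variables (C : finType) (z om : C -> rat) (t : rat) (D : nat).
Hypothesis z_neq0 : forall c, z c != 0.
Hypothesis t_neq0 : t != 0.
(** The functional [z^d |-> t^(d-1)] for [d > 0] and 0 otherwise, realised by weights on finitely
    many points for exponents up to [D]. *)
Hypothesis momentE : forall a b, (a <= D)%N -> (b <= D)%N ->
  \sum_c om c * (z c ^+ a * (z c)^-1 ^+ b) = if (b < a)%N then t ^+ (a - b.+1) else 0.

(** In the factorised Vandermonde each variable contributes [v c 1], which is z - 1/z, and [q c] to
    the power [e]. *)
Let y c := z c + (z c)^-1.
Let v c h := z c ^+ h - (z c)^-1 ^+ h.
Let q c := 1 - t * y c + t ^+ 2.

Lemma v_rec c h : y c * v c h.+1 = v c h.+2 + v c h.
Proof. by rewrite /y /v !exprS; move: (_ ^+ h) (_ ^+ h) => a b; field. Qed.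

Lemma sum_v h : (h < D)%N -> \sum_c om c * v c h.+1 = t ^+ h.
Proof.
move=> hD.
transitivity ((\sum_c om c * (z c ^+ h.+1 * (z c)^-1 ^+ 0))
              - \sum_c om c * (z c ^+ 0 * (z c)^-1 ^+ h.+1)).
  rewrite -sumrB; apply: eq_bigr => c _.
  by rewrite /v mulr1 mul1r mulrBr.
by rewrite !momentE //= subSS subn0 subr0.
Qed.

Lemma sum_v0 : \sum_c om c * v c 0 = 0.
Proof. by rewrite big1 // => c _; rewrite /v !expr0 subrr mulr0. Qed.

(** For [m = 0] the factor [q] cancels the dependence on [t]:
    [(1 + t^2) t^i - t (t^(i+1) + t^(i-1))] is 0 for [i > 0], and for [i = 0] the value is 1.
    Multiplying by [y] then reproduces the ballot recurrence. *)
Lemma sum_ballot i m : (i + m + 2 <= D)%N ->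
  \sum_c om c * (q c * v c i.+1 * y c ^+ m) = (ballot m i)%:R.
Proof.
elim: m i => [|m IH] i hD.
  transitivity ((1 + t ^+ 2) * (\sum_c om c * v c i.+1)
                - t * ((\sum_c om c * v c i.+2) + \sum_c om c * v c i)).
    rewrite -big_split !mulr_sumr -sumrB; apply: eq_bigr => c _ /=.
    by rewrite expr0 mulr1 -mulrDr -v_rec /q; ring.
  rewrite !sum_v; try lia.
  case: i hD => [|i] hD; first by rewrite sum_v0 /=; ring.
  by rewrite sum_v /=; [rewrite !exprS; ring | lia].
transitivity ((\sum_c om c * (q c * v c i.+2 * y c ^+ m))
              + \sum_c om c * (q c * v c i * y c ^+ m)).
  rewrite -big_split; apply: eq_bigr => c _ /=.
  by rewrite -mulrDr -mulrDl -mulrDr -v_rec exprS; ring.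
rewrite IH /=; last by lia.
case: i hD => [|i] hD; last by rewrite IH ?natrD 1?addrC //; lia.
rewrite big1 ?addr0 ?add0n // => c _.
by rewrite /v !expr0 subrr mulr0 mul0r mulr0.
Qed.

(** Multiplication by [y] is a step up or down in [h], and [v c 0 = 0] stops paths from going below
    0. *)
Lemma v1_expand c m B : (m < B)%N ->
  v c 1 * y c ^+ m = \sum_(h < B) (ballot m h)%:R * v c h.+1.
Proof.
elim: m B => [|m IH] B mB.
  case: B mB => // B _; rewrite big_ord_recl /= mul1r mulr1 big1 ?addr0 // => i _.
  by rewrite mul0r.
have v0 : v c 0 = 0 by rewrite /v !expr0 subrr.
rewrite exprS mulrCA (IH B.-1) ?mulr_sumr; last by lia.
case: B mB => //= B mB.
under eq_bigr do rewrite mulrCA v_rec mulrDr.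
rewrite big_split /=; under [RHS]eq_bigr do rewrite natrD mulrDl.
rewrite [RHS]big_split /=; congr (_ + _).
  by rewrite [RHS]big_ord_recl mul0r add0r.
transitivity (\sum_(h < B.+2) (ballot m h)%:R * v c h).
  by rewrite !big_ord_recr /= !ballot_gt ?mul0r ?addr0 //; lia.
by rewrite big_ord_recl v0 mulr0 add0r.
Qed.

Lemma sum_v1 m B : (m < B)%N -> (B <= D)%N ->
  \sum_c om c * (v c 1 * y c ^+ m) = \sum_(h < B) (ballot m h)%:R * t ^+ h.
Proof.
move=> mB BD; under eq_bigr do rewrite (v1_expand _ mB) mulr_sumr.
rewrite exchange_big /=; apply: eq_bigr => h _.
under eq_bigr do rewrite mulrCA.
by rewrite -mulr_sumr sum_v // (leq_trans _ BD).
Qed.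

(** Cuts a path from 0 to 0 at time [i]; obtained by expanding [y^i] and applying the functional. *)
Lemma ballot_gram i j B : (i < B)%N -> (i + j + 2 <= D)%N -> (B + j + 1 <= D)%N ->
  (ballot (i + j) 0)%:R = \sum_(h < B) (ballot i h)%:R * (ballot j h)%:R :> rat.
Proof.
move=> iB ijD BD; rewrite -sum_ballot //.
transitivity (\sum_(h < B) (ballot i h)%:R * \sum_c om c * (q c * v c h.+1 * y c ^+ j)).
  under [RHS]eq_bigr do rewrite mulr_sumr.
  rewrite exchange_big; apply: eq_bigr => c _.
  under eq_bigr do rewrite mulrCA; rewrite -mulr_sumr exprD; congr (_ * _).
  transitivity (q c * y c ^+ j * (v c 1 * y c ^+ i)); first by ring.
  by rewrite (v1_expand _ iB) mulr_sumr; apply: eq_bigr => h _; ring.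
apply: eq_bigr => h _; rewrite sum_ballot //.
by have := ltn_ord h; lia.
Qed.

(** The Hankel matrix is [M] times its transpose, with [M] lower unitriangular. *)
Lemma det_ballot_hankel w : (3 * w + 2 <= D)%N ->
  \det (\matrix_(i < w, j < w) (ballot (i + j) 0)%:R) = 1 :> rat.
Proof.
move=> wD; pose M : 'M[rat]_w := \matrix_(i < w, h < w) (ballot i h)%:R.
have -> : \matrix_(i < w, j < w) (ballot (i + j) 0)%:R = M *m M^T.
  apply/matrixP => i j; rewrite !mxE (@ballot_gram i j w) ?ltn_ord //.
  - by apply: eq_bigr => h _; rewrite !mxE.
  - by have := ltn_ord i; have := ltn_ord j; lia.
  - by have := ltn_ord i; have := ltn_ord j; lia.
suff dM : \det M = 1 by rewrite det_mulmx det_tr dM mulr1.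
rewrite det_trig; last by apply/is_trig_mxP => i j ij; rewrite mxE ballot_gt.
by apply: big1 => i _; rewrite mxE ballot_diag.
Qed.

Lemma chebyshevE c h : (chebyshev h).[y c] * v c 1 = v c h.+1.
Proof.
suff : (chebyshev h).[y c] * v c 1 = v c h.+1 /\
       (chebyshev h.+1).[y c] * v c 1 = v c h.+2 by case.
elim: h => [|h [IH1 IH2]].
  rewrite !hornerE; split=> //; rewrite v_rec /v !expr0 subrr addr0 //.
split=> //; change (chebyshev h.+2) with ('X * chebyshev h.+1 - chebyshev h).
by rewrite hornerD hornerN hornerM hornerX mulrBl -mulrA IH1 IH2 v_rec addrK.
Qed.

(** In each Leibniz term the functional acts on the variables separately, and the term survives
    exactly when [valid s]. The value t^(U-L-1) splits as t^U times t^(-L-1), a product of weights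
    of single columns as [valid_sum] requires. *)
Lemma sum_bialternant w e (l : 'I_(w + e + w) -> nat) :
  (forall p p' : 'I_(w + e + w), (p < p')%N -> (l p' < l p)%N) ->
  (forall p, (l p <= D)%N) ->
  \sum_(c : {ffun 'I_w -> C}) (\prod_j om (c j))
     * bialternant (@spectrum w e t (fun j => z (c j))) l
  = disjoint_sign_sum w e
    * \prod_(p < w + e + w) (if odd p then t^-1 ^+ (l p).+1 else t ^+ l p).
Proof.
move=> dec lD.
rewrite -(valid_sum (fun p => t ^+ l p) (fun p => t^-1 ^+ (l p).+1)).
have ltE p p' : (l p' < l p)%N = (p < p')%N.
  case: (ltngtP p p') => [/dec-> //|/dec h|/val_inj->]; last by rewrite ltnn.
  by rewrite ltnNge ltnW.
rewrite /bialternant /determinant; under eq_bigr do rewrite mulr_sumr.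
rewrite exchange_big [RHS]big_mkcond /=; apply: eq_bigr => s _.
pose U j := l (s (lshift w (lshift e j))).
pose L j := l (s (rshift (w + e) j)).
pose E := \prod_(i < e) t ^+ l (s (lshift w (rshift w i))).
transitivity ((-1) ^+ s * (E * \prod_j \sum_c om c * (z c ^+ U j * (z c)^-1 ^+ L j))).
  rewrite -sum_prod_ffun !mulr_sumr; apply: eq_bigr => c _.
  rewrite !big_split_ord /= mulrCA; congr (_ * _).
  rewrite [X in _ * (_ * X * _)](_ : _ = E); last first.
    by apply: eq_bigr => i _; rewrite mxE spectrum_lr.
  rewrite mulrCA -mulrA [X in _ = _ * X]big_split /= [in RHS]big_split /=.
  rewrite (eq_bigr (fun j => z (c j) ^+ U j)); last by move=> j _; rewrite mxE spectrum_ll.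
  rewrite [X in _ * (_ * (_ * X))](eq_bigr (fun j => (z (c j))^-1 ^+ L j)); last first.
    by move=> j _; rewrite mxE spectrum_r.
  by move: (\prod_j om _) => m1; ring.
(* The unbounded intervals, from the rows of [t], impose no condition. *)
have -> : valid s = [forall j : 'I_w, (L j < U j)%N].
  apply/forallP/forallP => h.
    by move=> j; rewrite ltE; have := h (lshift e j); rewrite /lower (unsplitK (inl j)).
  move=> i; rewrite /upper /lower; case: splitP => [j Ej|_ _]; last exact: ltn_ord.
  have -> : i = lshift e j by apply: val_inj.
  by rewrite -ltE h.
case: ifPn => [/forallP h|].
  congr (_ * _); rewrite big_split_ord /= [RHS]mulrAC [RHS]mulrC; congr (_ * _).
  rewrite -big_split; apply: eq_bigr => j _ /=.
  rewrite momentE ?lD // h -/(U j) -/(L j) -[in RHS](subnK (h j)) exprD exprVn.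
  by rewrite mulfK // expf_neq0.
rewrite negb_forall => /existsP[j nj].
by rewrite (bigD1 j) //= momentE ?lD // (negbTE nj) mul0r !mulr0.
Qed.

(** The functional is applied to p_1^n times the Vandermonde, expanded in bialternants on the left
    and factorised on the right. The constant does not depend on [n]. *)
Lemma lattice_words_moment w e : (e <= 1)%N -> exists k : rat, forall n,
  (n + (w + e + w) <= D)%N ->
  k * (\sum_(W : {ffun 'I_n -> 'I_(w + e + w)} | lattice_word W)
        \prod_(p < w + e + w) (if odd p then t^-1 else t) ^+ occ W n p)
  = \sum_(c : {ffun 'I_w -> C})
      (\prod_j (om (c j) * (v (c j) 1 * q (c j) ^+ e)))
      * vdm (fun j => y (c j)) * (vdm (fun j => y (c j)) * (t *+ e + \sum_j y (c j)) ^+ n).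
Proof.
move=> e1; set N := (w + e + w)%N.
have [k1 k1n k1E] := vdm_spectrum w t e1.
have [k2 k2n k2E] := bialternant_delta N.
pose c0 := \prod_(p < N) (if odd p then t^-1 ^+ (N - p.+1).+1 else t ^+ (N - p.+1)).
exists (disjoint_sign_sum w e * c0 / (k1 * k2)) => n nD.
have kn : k1 * k2 != 0 by rewrite mulf_neq0.
apply: (mulfI kn).
transitivity (\sum_(W : {ffun 'I_n -> 'I_N} | lattice_word W)
    \sum_(c : {ffun 'I_w -> C}) (\prod_j om (c j))
     * bialternant (@spectrum w e t (fun j => z (c j)))
         (fun p => occ W n p + (N - p.+1))%N).
  rewrite mulrA [X in X * _](_ : _ = disjoint_sign_sum w e * c0); last by rewrite mulrC divfK.
  rewrite mulr_sumr; apply: eq_bigr => W /lattice_wordP lW; rewrite sum_bialternant.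
  - rewrite -mulrA -big_split; congr (_ * _); apply: eq_bigr => p _ /=.
    by case: ifP => _; rewrite -exprD ?addSn addnC.
  - move=> p p' pp'; rewrite -addnS subnSK ?ltn_ord // leq_add ?lW ?(ltnW pp') //.
    exact: leq_sub2l.
  - by move=> p; apply: leq_trans nD; rewrite leq_add ?occ_le ?leq_subr.
rewrite exchange_big mulr_sumr; apply: eq_bigr => c _ /=.
have k1E' : vdm (@spectrum w e t (fun j => z (c j)))
    = k1 * (\prod_j (v (c j) 1 * q (c j) ^+ e)) * vdm (fun j => y (c j)) ^+ 2.
  by apply: k1E => j; apply: z_neq0.
rewrite -mulr_sumr sum_lattice_bialternant k2E k1E'.
rewrite [\prod_j (om _ * _)]big_split /=.
rewrite (_ : \sum_p _ = t *+ e + \sum_j y (c j)); last first.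
  rewrite !big_split_ord /= big_split /=.
  under eq_bigr do rewrite spectrum_ll.
  under [X in _ + X + _]eq_bigr do rewrite spectrum_lr.
  under [X in _ + _ + X]eq_bigr do rewrite spectrum_r.
  by rewrite sumr_const card_ord -addrA addrCA.
rewrite expr2; move: (_ ^+ n) (vdm _) (\prod_j om _) (\prod_j (_ * _)) => m1 m2 m3 m4.
ring.
Qed.

(** One [vdm] turns the product into a determinant with rows y^i, the other feeds [andreief]; the
    binomial theorem separates the powers of [t]. *)
Lemma moment_odd w n : (n + 2 * w + 2 <= D)%N ->
  \sum_(c : {ffun 'I_w -> C})
      (\prod_j (om (c j) * (v (c j) 1 * q (c j) ^+ 1)))
      * vdm (fun j => y (c j)) * (vdm (fun j => y (c j)) * (t *+ 1 + \sum_j y (c j)) ^+ n)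
  = w`!%:R * \sum_(k < n.+1) t ^+ k * odd_term w n k.
Proof.
move=> nD; pose g (i : 'I_w) c := om c * (v c 1 * q c) * y c ^+ i.
have gdet (c : {ffun 'I_w -> C}) :
    (\prod_j (om (c j) * (v (c j) 1 * q (c j) ^+ 1))) * vdm (fun j => y (c j))
    = \det (\matrix_(i < w, j < w) g i (c j)).
  rewrite -[LHS]mul1r -[X in X * _](@det1 rat w).
  rewrite [X in \det X](_ : _ = \matrix_(i < w, j < w) ('X^i : {poly rat})`_j); last first.
    by apply/matrixP => i j; rewrite !mxE coefXn eq_sym.
  rewrite -det_poly_eval; last by move=> i; rewrite size_polyXn.
  by congr (\det _); apply/matrixP => i j; rewrite !mxE hornerXn expr1.
transitivity (\sum_(k < n.+1) t ^+ k * ('C(n, k)%:R *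
   \sum_(c : {ffun 'I_w -> C}) \det (\matrix_(i < w, j < w) g i (c j))
     * (vdm (fun j => y (c j)) * (\sum_j y (c j)) ^+ (n - k)))).
  under eq_bigr => c _ do rewrite gdet mulr1n addrC exprDn !mulr_sumr.
  rewrite exchange_big; apply: eq_bigr => k _ /=.
  rewrite !mulr_sumr; apply: eq_bigr => c _.
  rewrite -mulr_natr; move: (\det _) (vdm _) ('C(_, _)%:R) (_ ^+ (n - k)) (t ^+ k).
  by move=> m1 m2 m3 m4 m5; ring.
rewrite mulr_sumr; apply: eq_bigr => k _; rewrite [RHS]mulrCA; congr (_ * _).
have kn : (k <= n)%N by rewrite -ltnS.
rewrite (@andreief _ _ g y n.+1 (n - k)); last by rewrite ltnS leq_subr.
rewrite mulrCA; congr (_ * _); rewrite mulr_sumr; apply: eq_big => u.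
  by apply/eqP/eqP; lia.
move=> /eqP su; rewrite mulrA; congr (_ * _).
  have fact0 a : (a`!)%:R != 0 :> rat by rewrite pnatr_eq0 -lt0n fact_gt0.
  rewrite -(bin_fact kn) !natrM; field; rewrite fact0 andbT.
  by apply/prodf_neq0 => j _.
congr (\det _); apply/matrixP => i j; rewrite !mxE.
rewrite -[RHS]sum_ballot; last first.
  apply: leq_trans nD; rewrite add0n leq_add2r mul2n -addnn addnA.
  by rewrite !leq_add ?(ltnW (ltn_ord _)) // -ltnS.
apply: eq_bigr => c _; rewrite /g !exprD.
by move: (y c ^+ u i) (y c ^+ i) (y c ^+ j) => m1 m2 m3; ring.
Qed.

(** Linearity in the last row, the only one that involves [k]. *)
Lemma det_ballot_last_row w n (u : {ffun 'I_w.+1 -> 'I_n.+1}) :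
  \det (\matrix_(i < w.+1, j < w.+1)
     if (i : nat) == w then \sum_(k < n.+1) t ^+ k * (ballot (u i + j) (w + k))%:R
     else (ballot (u i + j) i)%:R)
  = \sum_(k < n.+1) t ^+ k * \det (\matrix_(i < w.+1, j < w.+1)
                             (ballot (u i + j) (i + k * (i.+1 == w.+1)))%:R).
Proof.
rewrite (expand_det_row _ ord_max).
under [RHS]eq_bigr do rewrite (expand_det_row _ ord_max) mulr_sumr.
rewrite exchange_big; apply: eq_bigr => j _ /=.
rewrite !mxE /= eqxx mulr_suml; apply: eq_bigr => k _.
rewrite !mxE /= eqxx muln1 -mulrA; congr (_ * (_ * _)).
rewrite /cofactor; congr (_ * \det _); apply/matrixP => i' j'; rewrite !mxE.
set i1 := lift ord_max i'; have E : ((i1 : nat) == w) = false.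
  by rewrite /i1 lift_max ltn_eqF.
by rewrite eqSS E muln0 addn0.
Qed.

(** One [vdm] is rewritten in polynomials [p i] of degree at most [w], chosen so that the functional
    yields the required ballot numbers. The constant is the determinant of their coefficients, the
    same for all [n]. *)
Lemma moment_even w : exists k : rat, forall n, (n + 2 * w + 2 <= D)%N ->
  k * \sum_(c : {ffun 'I_w.+1 -> C})
      (\prod_j (om (c j) * (v (c j) 1 * q (c j) ^+ 0)))
      * vdm (fun j => y (c j)) * (vdm (fun j => y (c j)) * (t *+ 0 + \sum_j y (c j)) ^+ n)
  = w.+1`!%:R * \sum_(k < n.+1) t ^+ k * even_term w.+1 n k.
Proof.
pose Q : {poly rat} := (1 + t ^+ 2)%:P - t *: 'X.
have QE c : Q.[y c] = q c by rewrite !hornerE /q; ring.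
have sQ h : (h < w)%N -> (size (Q * chebyshev h)%R <= w.+1)%N.
  move=> hw; apply: leq_trans (size_polyMleq _ _) _.
  have s2 : (size Q <= 2)%N.
    rewrite (leq_trans (size_polyD _ _)) // size_polyN geq_max.
    rewrite (leq_trans (size_polyC_leq1 _)) //.
    by rewrite (leq_trans (size_scale_leq _ _)) ?size_polyX.
  by have := size_chebyshev h; lia.
(* In the last row, 1 yields the sum of all [t^h] times ballot numbers; subtracting the terms
   [h < w] leaves the heights [w + k], and [t^-1 ^+ w] reduces their weight to [t^k]. *)
pose p (i : 'I_w.+1) : {poly rat} := if (i : nat) == w then
    t^-1 ^+ w *: (1 - \sum_(h < w) t ^+ h *: (Q * chebyshev h)) else Q * chebyshev i.
have sp i : (size (p i) <= w.+1)%N.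
  rewrite /p; case: eqP => [_|ne]; last by apply: sQ; have := ltn_ord i; lia.
  rewrite (leq_trans (size_scale_leq _ _)) // (leq_trans (size_polyD _ _)) //.
  rewrite size_polyN geq_max size_poly1 /=.
  rewrite (leq_trans (size_sum _ _ _)) //; apply/bigmax_leqP => h _.
  by rewrite (leq_trans (size_scale_leq _ _)) // sQ.
pose g i c := om c * v c 1 * (p i).[y c].
exists (\det (\matrix_(i < w.+1, j < w.+1) (p i)`_j)) => n nD.
have gdet (c : {ffun 'I_w.+1 -> C}) :
    \det (\matrix_(i < w.+1, j < w.+1) (p i)`_j)
    * ((\prod_j (om (c j) * (v (c j) 1 * q (c j) ^+ 0))) * vdm (fun j => y (c j)))
    = \det (\matrix_(i < w.+1, j < w.+1) g i (c j)).
  rewrite -det_poly_eval //; congr (\det _); apply/matrixP => i j.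
  by rewrite !mxE expr0 mulr1.
rewrite mulr_sumr; under eq_bigr => c _ do rewrite mulrA gdet mulr0n add0r.
rewrite (andreief g y (ltnSn n)); congr (_ * _).
rewrite /even_term; under [RHS]eq_bigr do rewrite mulr_sumr.
rewrite exchange_big; apply: eq_bigr => u _ /=.
under [RHS]eq_bigr do rewrite mulrCA.
rewrite -mulr_sumr -det_ballot_last_row; congr (_ * \det _).
apply/matrixP => i j; rewrite !mxE; set m := (u i + j)%N.
have mn : (m <= n + w)%N by rewrite leq_add // -ltnS.
have row_ballot h : (h < w)%N ->
    \sum_c om c * v c 1 * (Q * chebyshev h).[y c] * y c ^+ m = (ballot m h)%:R.
  move=> hw; rewrite -sum_ballot; last by lia.
  apply: eq_bigr => c _; rewrite hornerM QE -(chebyshevE c h).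
  by move: (chebyshev h).[_] (_ ^+ m) => m1 m2; ring.
rewrite /g /p; case: eqP => [_|ne]; last by apply: row_ballot; have := ltn_ord i; lia.
transitivity (t^-1 ^+ w * (\sum_c om c * (v c 1 * y c ^+ m)
   - \sum_(h < w) t ^+ h * \sum_c om c * v c 1 * (Q * chebyshev h).[y c] * y c ^+ m)).
  under [X in _ * (_ - X)]eq_bigr do rewrite mulr_sumr.
  rewrite [X in _ * (_ - X)]exchange_big -sumrB mulr_sumr; apply: eq_bigr => c _ /=.
  rewrite hornerZ hornerD hornerN hornerC horner_sum.
  rewrite (eq_bigr (fun h : 'I_w => t ^+ h * (Q * chebyshev h).[y c])); last first.
    by move=> h _; rewrite hornerZ.
  rewrite [X in _ = _ * (_ - X)](_ : _ = om c * v c 1 * y c ^+ m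
      * \sum_(h < w) t ^+ h * (Q * chebyshev h).[y c]); last first.
    rewrite mulr_sumr; apply: eq_bigr => h _.
    by move: (_.[_]) (t ^+ h) (y c ^+ m) => m1 m2 m3; ring.
  by move: (\sum_(h < w) _) (y c ^+ m) (t^-1 ^+ w) => m1 m2 m3; ring.
(* [w + n.+1] exceeds [m <= n + w]; the terms [h < w] then cancel against the subtracted sum. *)
rewrite (@sum_v1 m (w + n.+1)); try lia.
rewrite big_split_ord /= [X in _ * (X + _ - _)](_ : _ = \sum_(h < w) t ^+ h *
    \sum_c om c * v c 1 * (Q * chebyshev h).[y c] * y c ^+ m); last first.
  by apply: eq_bigr => h _; rewrite row_ballot // mulrC.
rewrite addrC addKr mulr_sumr; apply: eq_bigr => k _.
by rewrite mulrCA exprD [X in _ * X]mulrA -exprMn mulVf // expr1n mul1r mulrC.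
Qed.

End Moments.

(** * Generating functions of lattice words *)

Lemma sum_ffun1 w (P : pred {ffun 'I_w -> 'I_1}) (G : {ffun 'I_w -> 'I_1} -> rat) :
  P [ffun=> ord0] -> \sum_(u | P u) G u = G [ffun=> ord0].
Proof.
move=> P0; apply: big_pred1 => u; have -> : u = [ffun=> ord0].
  by apply/ffunP => i; rewrite ffunE ord1.
by rewrite P0 /= eqxx.
Qed.

Lemma weights_exist D (t : rat) : exists om : 'I_(2 * D).+1 -> rat,
  forall a b, (a <= D)%N -> (b <= D)%N ->
  \sum_c om c * ((c.+1)%:R ^+ a * (c.+1)%:R^-1 ^+ b)
  = if (b < a)%N then t ^+ (a - b.+1) else 0.
Proof.
have [om omE] := moment_weights D (fun d => if (D < d)%N then t ^+ (d - D.+1) else 0).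
exists om => a b aD bD; rewrite omE //.
have -> : (D < D + a - b)%N = (b < a)%N by apply/idP/idP; lia.
by case: ifP => // ba; congr (_ ^+ _); lia.
Qed.

(** The constant [k] is found at length 0, where only the empty word occurs and the right side is a
    Hankel determinant equal to 1. *)
Lemma lattice_words_odd w n (t : rat) : t != 0 ->
  \sum_(W : {ffun 'I_n -> 'I_(w + 1 + w)} | lattice_word W)
     \prod_(p < w + 1 + w) (if odd p then t^-1 else t) ^+ occ W n p
  = \sum_(k < n.+1) t ^+ k * odd_term w n k.
Proof.
(* [D] is large enough for all lengths up to [n], so that one constant serves both [n] and 0. *)
move=> t0; pose D := (n + 4 * w + 5)%N; have [om omE] := weights_exist D t.
have z0 (c : 'I_(2 * D).+1) : (c.+1)%:R != 0 :> rat by rewrite pnatr_eq0.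
have [k kE] := lattice_words_moment z0 t0 omE w (leqnn 1).
have w0 : w`!%:R != 0 :> rat by rewrite pnatr_eq0 -lt0n fact_gt0.
pose S n' := \sum_(W : {ffun 'I_n' -> 'I_(w + 1 + w)} | lattice_word W)
     \prod_(p < w + 1 + w) (if odd p then t^-1 else t) ^+ occ W n' p.
have SE n' : (n' <= n)%N ->
    k * S n' = w`!%:R * \sum_(k < n'.+1) t ^+ k * odd_term w n' k.
  by move=> hn; apply: etrans (kE n' _) (moment_odd z0 t0 omE _); rewrite /D; lia.
have k1 : k = w`!%:R.
  have S0 : S 0%N = 1.
    by apply: sum_words0 => W; apply: big1 => p _; rewrite /occ big_ord0.
  have := SE 0%N (leq0n n); rewrite S0 mulr1 big_ord1 mul1r => ->.
  rewrite /odd_term sum_ffun1; last by rewrite add0n big1 // => j _; rewrite ffunE.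
  rewrite [\prod_j _]big1 ?mulr1 ?divr1 ?mul1r; last by move=> j _; rewrite ffunE.
  rewrite (_ : \matrix_(i, j) _ = \matrix_(i < w, j < w) (ballot (i + j) 0)%:R).
    by rewrite (det_ballot_hankel z0 t0 omE) ?mulr1 // /D; lia.
  by apply/matrixP => i j; rewrite !mxE ffunE add0n.
by apply: (mulfI w0); rewrite -{1}k1; apply: SE.
Qed.

(** As in the odd case; at length 0 the matrix of ballot numbers is unitriangular. *)
Lemma lattice_words_even w n (t : rat) : t != 0 ->
  \sum_(W : {ffun 'I_n -> 'I_(w.+1 + 0 + w.+1)} | lattice_word W)
     \prod_(p < w.+1 + 0 + w.+1) (if odd p then t^-1 else t) ^+ occ W n p
  = \sum_(k < n.+1) t ^+ k * even_term w.+1 n k.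
Proof.
move=> t0; pose D := (n + 4 * w + 5)%N; have [om omE] := weights_exist D t.
have z0 (c : 'I_(2 * D).+1) : (c.+1)%:R != 0 :> rat by rewrite pnatr_eq0.
have [k kE] := lattice_words_moment z0 t0 omE w.+1 (leq0n 1).
have [k' k'E] := moment_even z0 t0 omE w.
have w0 : w.+1`!%:R != 0 :> rat by rewrite pnatr_eq0 -lt0n fact_gt0.
pose S n' := \sum_(W : {ffun 'I_n' -> 'I_(w.+1 + 0 + w.+1)} | lattice_word W)
     \prod_(p < w.+1 + 0 + w.+1) (if odd p then t^-1 else t) ^+ occ W n' p.
have SE n' : (n' <= n)%N ->
    k' * k * S n' = w.+1`!%:R * \sum_(k < n'.+1) t ^+ k * even_term w.+1 n' k.
  move=> hn; rewrite -mulrA; apply: etrans (congr1 _ (kE n' _)) (k'E n' _); rewrite /D; lia.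
have k1 : k' * k = w.+1`!%:R.
  have S0 : S 0%N = 1.
    by apply: sum_words0 => W; apply: big1 => p _; rewrite /occ big_ord0.
  have := SE 0%N (leq0n n); rewrite S0 mulr1 big_ord1 mul1r => ->.
  rewrite /even_term sum_ffun1; last by rewrite big1 // => j _; rewrite ffunE.
  rewrite [\prod_j _]big1 ?divr1 ?mul1r; last by move=> j _; rewrite ffunE.
  rewrite -det_tr det_trig.
    by rewrite big1 ?mulr1 // => i _; rewrite !mxE ffunE mul0n addn0 ballot_diag.
  by apply/is_trig_mxP => i j ij; rewrite !mxE ffunE mul0n addn0 ballot_gt.
by apply: (mulfI w0); rewrite -{1}k1; apply: SE.
Qed.
(** * Comparison of coefficients *)

Lemma odd_rows_le n (la : partition_of n) : (odd_rows la <= n)%N.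
Proof. exact: leq_trans (count_size _ _) (size_parts la). Qed.

(** The difference is a polynomial of degree at most [n] vanishing at 1, ..., n + 1. *)
Lemma eq_coef_of_eq_value n (a b : nat -> rat) :
  (forall t : rat, t != 0 ->
     \sum_(k < n.+1) t ^+ k * a k = \sum_(k < n.+1) t ^+ k * b k) ->
  forall k, (k <= n)%N -> a k = b k.
Proof.
move=> E k kn; pose p := \poly_(k < n.+1) (a k - b k).
suff p0 : p = 0.
  apply/eqP; rewrite -subr_eq0; apply/eqP.
  by have := coef_poly n.+1 (fun k => a k - b k) k; rewrite -/p p0 coef0 ltnS kn.
apply/eqP/negPn/negP => pn0.
pose rs := [seq (i.+1)%:R : rat | i <- iota 0 n.+1].
have us : uniq rs.
  by rewrite map_inj_uniq ?iota_uniq // => i j /eqP; rewrite eqr_nat => /eqP[].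
have rp : all (root p) rs.
  apply/allP => _ /mapP[i _ ->]; rewrite rootE horner_poly.
  have t0 : (i.+1)%:R != 0 :> rat by rewrite pnatr_eq0.
  have := E _ t0 => /eqP; rewrite -subr_eq0 -sumrB => /eqP h.
  by apply/eqP; rewrite -[RHS]h; apply: eq_bigr => j _; rewrite mulrC mulrBr.
have := max_poly_roots pn0 rp us; rewrite size_map size_iota ltnNge.
by rewrite size_poly.
Qed.

Lemma sum_SYT_by_odd_rows N n (t : rat) :
  \sum_(la : partition_of n | (part1 la <= N)%N) (num_SYT la)%:R * t ^+ odd_rows la
  = \sum_(k < n.+1) t ^+ k *
      \sum_(la : partition_of n | (part1 la <= N)%N && (odd_rows la == k))
         (num_SYT la)%:R.
Proof.
rewrite (partition_big (fun la => inord (odd_rows la) : 'I_n.+1) xpredT) //=.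
apply: eq_bigr => k _; rewrite mulr_sumr; apply: eq_big => la.
  by rewrite -val_eqE /= inordK // ltnS odd_rows_le.
by move=> /andP[_ /eqP <-]; rewrite inordK ?ltnS ?odd_rows_le // mulrC.
Qed.

Lemma multinomial_ffun w n m (u : {ffun 'I_w -> 'I_m}) : (\sum_i u i = n)%N ->
  (multinomial n [seq (u i : nat) | i : 'I_w])%:R
  = n`!%:R / \prod_i ((u i)`!)%:R :> rat.
Proof.
move=> su; rewrite multinomialE; first by rewrite big_image.
by rewrite sumnE big_image.
Qed.

(** The guard of the second identity leaves out only [w = n = 0 < k], where the left sum is empty
    and the right side is the empty determinant 1. *)
Theorem theorem1p9 (k w n : nat) :
  \sum_(la : partition_of n
          | (part1 la <= 2 * w + 1)%N && (odd_rows la == k))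
     (num_SYT la)%:R
  = \sum_(t : {ffun 'I_w -> 'I_n.+1} | (k + \sum_(i < w) t i == n)%N)
      (multinomial n (k :: [seq (t i : nat) | i : 'I_w]))%:R
      * \det (\matrix_(i < w, j < w)
                Cat (((t i)%:R + (i.+1)%:R + (j.+1)%:R - 2) / 2))
      :> rat
  /\
  (((0 < w)%N \/ (0 < n)%N \/ k = 0%N) ->
   \sum_(la : partition_of n
           | (part1 la <= 2 * w)%N && (odd_rows la == k))
      (num_SYT la)%:R
   = \sum_(t : {ffun 'I_w -> 'I_n.+1} | (\sum_(i < w) t i == n)%N)
       (multinomial n [seq (t i : nat) | i : 'I_w])%:R
       * \det (\matrix_(i < w, j < w)
                 F (t i + j.+1 - 1)%N
                   (((t i)%:R - (i.+1)%:R - k%:R * (i.+1 == w)%:R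
                     + (j.+1)%:R) / 2))
       :> rat).
Proof.
have lhs0 N : (n < k)%N -> \sum_(la : partition_of n | (part1 la <= N)%N && (odd_rows la == k))
    (num_SYT la)%:R = 0 :> rat.
  move=> nk; apply: big_pred0 => la; apply/negbTE/nandP; right.
  by rewrite ltn_eqF // (leq_ltn_trans (odd_rows_le la)).
split.
  transitivity (odd_term w n k); last first.
    rewrite /odd_term; apply: eq_bigr => u /eqP su; congr (_ * _).
      rewrite multinomialE; last by rewrite /= sumnE big_image.
      by rewrite big_cons big_image.
    congr (\det _).
    apply/matrixP => i j; rewrite !mxE -Cat_half; congr Cat.
    by rewrite !natrD -[i.+1%:R]natr1 -[j.+1%:R]natr1; ring.
  (* Comparing coefficients reaches only [k <= n]; beyond that both sides are 0. *)
  have [nk|kn] := ltnP n k.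
    by rewrite lhs0 // /odd_term big_pred0 // => u; apply/eqP; lia.
  have -> : (2 * w + 1 = w + 1 + w)%N by lia.
  apply: (@eq_coef_of_eq_value n (fun k => \sum_(la : partition_of n |
     (part1 la <= w + 1 + w)%N && (odd_rows la == k)) (num_SYT la)%:R)) kn => t t0.
  by rewrite -sum_SYT_by_odd_rows sum_SYT_words // lattice_words_odd.
(* For [w = 0] there is no last row, and both sides are evaluated directly: 0 for [n > 0], and 1 for
   [n = k = 0]. *)
case: w => [|w] guard.
  have [n0|n_gt0] := posnP n; last first.
    rewrite !big_pred0 // => [u|la]; first by rewrite big_ord0 ltn_eqF.
    apply/negbTE/nandP; left; rewrite muln0 leqn0 -lt0n.
    rewrite /part1 -nth0 row_len_gt0 lt0n size_eq0; apply/eqP => E.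
    by have /and3P[_ _] := partsP la; rewrite E /= ltn_eqF.
  have k0 : k = 0%N by move: guard; rewrite n0; case=> [|[]].
  clear lhs0 guard; subst n k.
  rewrite [RHS](_ : _ = 1); last first.
    rewrite sum_ffun1 ?big_ord0 //.
    by rewrite (@multinomial_ffun _ 0%N) ?big_ord0 // det_mx00 mulr1 ?big_ord0 divr1.
  transitivity (\sum_(la : partition_of 0 | (part1 la <= 0)%N)
                  (num_SYT la)%:R * 1 ^+ odd_rows la : rat); last first.
    by rewrite sum_SYT_words ?oner_eq0 //; apply: sum_words0 => W; rewrite big_ord0.
  apply: eq_big => la; last by rewrite expr1n mulr1 => _.
  by have := odd_rows_le la; rewrite leqn0 => ->; rewrite andbT.
transitivity (even_term w.+1 n k); last first.
  rewrite /even_term; apply: eq_bigr => u /eqP su; rewrite (multinomial_ffun su).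
  congr (_ * _); congr (\det _).
  apply/matrixP => i j; rewrite !mxE addnS subn1 /= -F_half; congr F.
  rewrite !natrD natrM -[i.+1%:R]natr1 -[j.+1%:R]natr1; congr (_ / _); ring.
have [nk|kn] := ltnP n k.
  (* The last row vanishes: its height [w + k] exceeds the path length, which is at most [n + w]. *)
  rewrite lhs0 // /even_term big1 // => u _.
  rewrite (expand_det_row _ ord_max) [X in _ * X]big1 ?mulr0 // => j _.
  rewrite mxE /= eqxx muln1 ballot_gt ?mul0r //.
  by rewrite addnC -addnS leq_add // ?(leq_trans (ltn_ord _) nk) // -ltnS ltn_ord.
have -> : (2 * w.+1 = w.+1 + 0 + w.+1)%N by lia.
apply: (@eq_coef_of_eq_value n (fun k => \sum_(la : partition_of n |
   (part1 la <= w.+1 + 0 + w.+1)%N && (odd_rows la == k)) (num_SYT la)%:R)) kn => t t0.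
by rewrite -sum_SYT_by_odd_rows sum_SYT_words // lattice_words_even.
Qed.
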